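(* Let $H$ be a separable complex Hilbert space and let $A\in\mathcal{B}_1(H)$. Then the following conditions are equivalent: (1) $w_1(A)=\|A\|_1$. (2) There exists $\theta\in\mathbb{R}$ such that $\|A+e^{i\theta}A^*\|_1=\|A\|_1+\|A^*\|_1$ (i.e. $A\parallel^1A^*$). (3) There exist a partial isometry $V$ and $\lambda\in\mathbb{T}$ such that $A=V|A|$ and $A^*=\lambda V|A^*|$. (4) There exists $\lambda\in\mathbb{T}$ such that $$\big|\mathrm{tr}(|A|)+\lambda\,\mathrm{tr}(U^*A^* )\big|\le\big\|P_{\ker A^*}(A+\lambda A^* )P_{\ker A}\big\|_1,$$ where $A=U|A|$ is the polar decomposition of $A$. (5) There exists $\lambda\in\mathbb{T}$ such that $(A^* )^2=\lambda|A||A^*|$. (6) There exist isometries $V,W$ and $\lambda\in\mathbb{T}$ such that $|A+\lambda A^*|=V|A|V^*+W|A^*|W^*$. (7) There exists $\lambda\in\mathbb{T}$ such that $|A+\lambda A^*|=|A|+|A^*|$. (8) There exist $\theta\in\mathbb{R}$ and a closed subspace $\mathcal{M}$ of $H$ such that $$\|A\|_1=\mathrm{tr}\big(P_{\mathcal{M}}e^{-i\frac\theta2}AP_{\mathcal{M}}\big)-\mathrm{tr}\big(P_{\mathcal{M}^\perp}e^{-i\frac\theta2}AP_{\mathcal{M}^\perp}\big),$$ with $P_{\mathcal{M}}e^{-i\frac\theta2}AP_{\mathcal{M}}\ge0$ and $P_{\mathcal{M}^\perp}e^{-i\frac\theta2}AP_{\mathcal{M}^\perp}\le0$. If $H$ is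 finite dimensional, of dimension $n$, then (1) to (8) are also equivalent to (9) There exists $F\in\mathbb{M}_n$ such that $\|F\|\le1$ and $\mathrm{tr}(AF^* )=\|A\|_1=|\mathrm{tr}(A^*F^* )|$. Furthermore, if $A$ is invertible, all the previous conditions are equivalent to (10) $\big|\mathrm{tr}(|A|A^{-1}A^* )\big|=\|A^*\|_1$.
   Context: $\mathbb{T}=\{\alpha\in\mathbb{C}:|\alpha|=1\}$; $|T|=(T^*T)^{1/2}$ for $T\in\mathcal{B}(H)$. $\mathcal{B}_1(H)$ is the trace class, i.e. the compact operators $A$ on $H$ with $\|A\|_1=\mathrm{tr}|A|<\infty$. For $T\in\mathcal{B}(H)$, $Re(T)=\frac{T+T^*}{2}$, and $w_1(A)=\sup_{\theta\in\mathbb{R}}\|Re(e^{i\theta}A)\|_1$. $P_{\mathcal{S}}$ denotes the orthogonal projection onto a closed subspace $\mathcal{S}$. $\mathbb{M}_n$ is the algebra of complex $n\times n$ matrices, identified with $\mathcal{B}(H)$ when $\dim H=n$, and $\|\cdot\|$ is the operator norm. *)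

(* Defs.v *)
From HB Require Import structures.
From mathcomp Require Import all_boot all_order all_algebra.
From mathcomp Require Import all_classical all_reals all_analysis.
From mathcomp Require Import complex.

Set Implicit Arguments.
Unset Strict Implicit.
Unset Printing Implicit Defensive.

Import Order.TTheory GRing.Theory Num.Theory.
Import numFieldNormedType.Exports.

Local Open Scope classical_set_scope.
Local Open Scope ring_scope.
Local Open Scope complex_scope.

(* Complex Hilbert spaces: complete normed modules over R[i] whose norm is
   induced by an inner product, linear in its first argument. The norm of a
   normed module over R[i] takes its values in R[i]; since z <= z' in R[i]
   means that z' - z is a nonnegative real, it is real and nonnegative. *)
HB.mixin Record NormedModule_isHilbert (R : realType) H
    of CompleteNormedModule R[i] H := {
  inner : H -> H -> R[i] ;
  inner_scalar : forall y : H, scalar (inner^~ y) ;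
  inner_conj : forall x y : H, inner y x = (inner x y)^* ;
  inner_norm : forall x : H, inner x x = `|x| ^+ 2
}.

#[short(type="hilbertType")]
HB.structure Definition Hilbert (R : realType) :=
  {H of NormedModule_isHilbert R H & CompleteNormedModule R[i] H}.

Definition expi (R : realType) (t : R) : R[i] := cos t +i* sin t.

Section Operators.
Context {R : realType} {H : hilbertType R}.
Implicit Types (T S P U V F : H -> H) (M : set H).

Definition separable_space : Prop := exists2 D : set H, countable D & dense D.

Definition has_dim (n : nat) : Prop :=
  exists b : 'I_n -> H,
    forall x : H, exists! c : 'rV[R[i]]_n, x = \sum_(i < n) c 0 i *: b i.

Definition bounded_op T : Prop := linear T /\ continuous T.

Definition opnorm T : \bar R :=
  ereal_sup [set (complex.Re `|T x|)%:E | x in [set x : H | `|x| <= 1]].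

(* The adjoint, the square root and the other operators characterized below
   by their properties are selected by choice; they are unique when they
   exist, and the default value is irrelevant. *)
Definition adjop T : H -> H :=
  xget 0 [set S | bounded_op S /\ forall x y, inner (T x) y = inner x (S y)].

(* The order of R[i] makes this self-adjointness and nonnegativity at once. *)
Definition positive_op T : Prop :=
  bounded_op T /\ forall x, 0 <= inner (T x) x.

Definition negative_op T : Prop :=
  bounded_op T /\ forall x, inner (T x) x <= 0.

Definition opsqrt P : H -> H :=
  xget 0 [set S | positive_op S /\ S \o S = P].

Definition opabs T : H -> H := opsqrt (adjop T \o T).

Definition opRe T : H -> H := 2^-1 *: (T + adjop T).

Definition opker T : set H := [set x | T x = 0].

Definition orthocomp M : set H :=
  [set x | forall y, M y -> inner x y = 0].

Definition closed_subspace M : Prop :=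
  [/\ closed M, M 0 & forall (a : R[i]) x y, M x -> M y -> M (a *: x + y)].

Definition orthproj M : H -> H :=
  xget 0 [set P | forall x, M (P x) /\ orthocomp M (x - P x)].

Definition isometry_op V : Prop := linear V /\ forall x, `|V x| = `|x|.

Definition partial_isometry V : Prop :=
  bounded_op V /\ forall x, orthocomp (opker V) x -> `|V x| = `|x|.

(* The partial isometry U of the polarop decomposition T = U |T|. *)
Definition polarop T : H -> H :=
  xget 0 [set U | [/\ partial_isometry U, T = U \o opabs T & opker U = opker T]].

Definition compact_op T : Prop :=
  linear T /\ compact (closure (T @` [set x : H | `|x| <= 1])).

(* Orthonormal bases (e i)_{i \in I} with I included in nat, so that spaces of
   finite and of countably infinite dimension are treated uniformly. *)
Definition is_onb (I : set nat) (e : nat -> H) : Prop :=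
  (forall i j, I i -> I j -> inner (e i) (e j) = (i == j)%:R) /\
  (forall x, (forall i, I i -> inner x (e i) = 0) -> x = 0).

Definition onb : set nat * (nat -> H) :=
  xget (set0, fun=> 0) [set b | is_onb b.1 b.2].

(* The value does not depend on the orthonormal basis selected by onb when T is
   trace class. *)
Definition optr T : R[i] :=
  limn ((fun n => \sum_(0 <= i < n | i \in onb.1) inner (T (onb.2 i)) (onb.2 i))
        : nat -> R[i]^o).

(* tr |T|, as an element of [0, +oo]. *)
Definition trnorm T : \bar R :=
  (\sum_(0 <= i <oo | i \in onb.1)
     (complex.Re (inner (opabs T (onb.2 i)) (onb.2 i)))%:E)%E.

Definition trace_class T : Prop := compact_op T /\ (trnorm T < +oo)%E.

(* The trace norm of a trace-class operator, as a complex number. *)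
Definition trnormC T : R[i] := (fine (trnorm T))%:C.

Definition w1 T : \bar R :=
  ereal_sup (range (fun t : R => trnorm (opRe (expi t *: T)))).

End Operators.

Arguments separable_space {R} H.
Arguments has_dim {R} H n.

(* Main.v *)
Require Import Defs.
From mathcomp Require Import all_boot all_order all_algebra.
From mathcomp Require Import all_classical all_reals all_analysis.
From mathcomp Require Import complex ring lra.

Set Implicit Arguments.
Unset Strict Implicit.
Unset Printing Implicit Defensive.

Import Order.TTheory GRing.Theory Num.Theory.
Import numFieldNormedType.Exports.

Local Open Scope classical_set_scope.
Local Open Scope ring_scope.
Local Open Scope complex_scope.

(* Everything is reduced to the existence of a contraction F and of a
   unimodular lam with tr (F A) = ||A||_1 = lam tr (F A^* ), i.e., of a common
   norming functional of A and lam A^* for the duality of the trace class with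
   the bounded operators. The equality case of |tr (F T)| <= ||T||_1 is
   F T = |T|; hence F A = |A| and lam F A^* = |A^*|, which gives (3), then (5)
   and, by squaring, (7). For (4), F = U^* + z K with K mapping ker A^* to
   ker A. For (8), F is the sign of the real part of e^(-i theta/2) A. The
   trace is handled through Hilbert-Schmidt factors: a trace-class operator is
   T = (U K) K with K = |T|^(1/2), and the trace of a product of two
   Hilbert-Schmidt operators is, by polarization, a combination of
   Hilbert-Schmidt norms, so that its cyclicity follows from the invariance of
   these norms under taking adjoints. *)

(** * Inner product and norm *)

(** The scalar differs between conditions. The [lam] of (2), (6), (7) and of [norming] becomes its
    conjugate in (3) and (5), because V = F^* there, and its opposite in (4): the inequality in (4)
    says exactly that some z of modulus at most 1, multiplied by the trace norm on the right,
    cancels the sum on the left. A norming F comes from (2) as the adjoint of the polar part of A +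
    lam A^*: its trace against the sum is ||A||_1 + ||A^*||_1, while neither term can exceed its own
    norm. No spectral theorem is used. Square roots come from an iteration, the sign of a
    self-adjoint T from the reflection in the kernel of |T| - T, and equality of operators from
    equality of traces because a series of nonnegative terms with sum 0 has only zero terms.
    Adjoints, square roots, polar parts and projections are picked by choice, so existence has to be
    proved before any property, and absolute values are identified by uniqueness of positive
    roots. *)

Section HilbertBasics.
Context {R : realType} {H : hilbertType R}.
Implicit Types (x y z : H) (a b : R[i]).

Lemma innerC x y : inner y x = (inner x y)^*%R.
Proof. exact: inner_conj. Qed.

Lemma innerDl x y z : inner (x + y) z = inner x z + inner y z.
Proof. by have := inner_scalar z 1 x y; rewrite scale1r mul1r. Qed.

Lemma inner0l z : inner (0 : H) z = 0.
Proof. by apply: (addIr (inner 0 z)); rewrite -innerDl !add0r. Qed.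

Lemma innerZl a x z : inner (a *: x) z = a * inner x z.
Proof. by have := inner_scalar z a x 0; rewrite !addr0 inner0l addr0. Qed.

Lemma innerNl x z : inner (- x) z = - inner x z.
Proof. by rewrite -scaleN1r innerZl mulN1r. Qed.

Lemma innerBl x y z : inner (x - y) z = inner x z - inner y z.
Proof. by rewrite innerDl innerNl. Qed.

Lemma inner0r z : inner z (0 : H) = 0.
Proof. by rewrite innerC inner0l conjC0. Qed.

Lemma innerDr x y z : inner z (x + y) = inner z x + inner z y.
Proof. by rewrite innerC innerDl rmorphD /= -!innerC. Qed.

Lemma innerZr a x z : inner z (a *: x) = a^*%R * inner z x.
Proof. by rewrite innerC innerZl rmorphM /= -!innerC. Qed.

Lemma innerNr x z : inner z (- x) = - inner z x.
Proof. by rewrite innerC innerNl rmorphN /= -!innerC. Qed.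

Lemma innerBr x y z : inner z (x - y) = inner z x - inner z y.
Proof. by rewrite innerDr innerNr. Qed.

Definition innerE := (innerDl, innerDr, innerNl, innerNr, innerZl, innerZr).

Lemma inner_suml (I : Type) (r : seq I) (P : pred I) (F : I -> H) z :
  inner (\sum_(i <- r | P i) F i) z = \sum_(i <- r | P i) inner (F i) z.
Proof. by elim/big_rec2: _ => [|i u v _ <-]; rewrite ?inner0l ?innerDl. Qed.

(** Real-valued versions of the inner product and of the norm, so that inequalities are settled in
    the ordered field R instead of R[i]. *)
Definition rdot x y : R := complex.Re (inner x y).
Definition rnorm x : R := complex.Re `|x|.

Lemma rnormE x : `|x| = (rnorm x)%:C.
Proof. by rewrite /rnorm RRe_real// normr_real. Qed.

Lemma rnorm_ge0 x : 0 <= rnorm x.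
Proof. by rewrite -ler0c -rnormE. Qed.

Lemma inner_self x : inner x x = (rnorm x ^+ 2)%:C.
Proof. by rewrite inner_norm rnormE -rmorphXn. Qed.

Lemma rdot_self x : rdot x x = rnorm x ^+ 2.
Proof. by rewrite /rdot inner_self. Qed.

Lemma rdotC x y : rdot x y = rdot y x.
Proof. by rewrite /rdot innerC; case: (inner y x). Qed.

Lemma rdotDl x y z : rdot (x + y) z = rdot x z + rdot y z.
Proof. by rewrite /rdot innerDl; case: (inner x z) (inner y z) => ? ? []. Qed.

Lemma rdotDr x y z : rdot z (x + y) = rdot z x + rdot z y.
Proof. by rewrite rdotC rdotDl !(rdotC z). Qed.

Lemma rdotNl x z : rdot (- x) z = - rdot x z.
Proof. by rewrite /rdot innerNl; case: (inner x z). Qed.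

Lemma rdotNr x z : rdot z (- x) = - rdot z x.
Proof. by rewrite rdotC rdotNl rdotC. Qed.

Lemma rdotZl (t : R) x z : rdot (t%:C *: x) z = t * rdot x z.
Proof. by rewrite /rdot innerZl; case: (inner x z) => u v /=; rewrite mul0r subr0. Qed.

Lemma rdotZr (t : R) x z : rdot z (t%:C *: x) = t * rdot z x.
Proof. by rewrite rdotC rdotZl rdotC. Qed.

Definition rdotE := (rdotDl, rdotDr, rdotNl, rdotNr, rdotZl, rdotZr).

Lemma rnorm0 : rnorm 0 = 0.
Proof. by rewrite /rnorm normr0. Qed.

Lemma rnorm_eq0 x : rnorm x = 0 -> x = 0.
Proof. by move=> x0; apply/eqP; rewrite -normr_eq0 rnormE x0. Qed.

Lemma rnorm_sqr_le0 x : rnorm x ^+ 2 <= 0 -> x = 0.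
Proof. by move=> h; apply/rnorm_eq0/eqP; rewrite -sqrf_eq0 eq_le h sqr_ge0. Qed.

Lemma rnormN x : rnorm (- x) = rnorm x.
Proof. by rewrite /rnorm normrN. Qed.

Lemma rnormBC x y : rnorm (x - y) = rnorm (y - x).
Proof. by rewrite -rnormN opprB. Qed.

Lemma rnormZ a x : rnorm (a *: x) = complex.Re `|a| * rnorm x.
Proof.
rewrite {1}/rnorm normrZ rnormE.
by case: (`|a| : R[i]) => u v /=; rewrite mulr0 subr0.
Qed.

Lemma rnormZR (t : R) x : rnorm (t%:C *: x) = `|t| * rnorm x.
Proof. by rewrite rnormZ normc_def /= expr0n addr0 sqrtr_sqr. Qed.

Lemma rnorm_triangle x y : rnorm (x + y) <= rnorm x + rnorm y.
Proof. by rewrite -lecR rmorphD /= -!rnormE ler_normD. Qed.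

Lemma rnorm_triangleB x y z : rnorm (x - z) <= rnorm (x - y) + rnorm (y - z).
Proof. by have := rnorm_triangle (x - y) (y - z); rewrite addrA subrK. Qed.

Lemma rnormD_sqr x y : rnorm (x + y) ^+ 2 = rnorm x ^+ 2 + 2 * rdot x y + rnorm y ^+ 2.
Proof. rewrite -!rdot_self !rdotE (rdotC y x); ring. Qed.

Lemma rnormB_sqr x y : rnorm (x - y) ^+ 2 = rnorm x ^+ 2 - 2 * rdot x y + rnorm y ^+ 2.
Proof. rewrite -!rdot_self !rdotE (rdotC y x); ring. Qed.

Lemma inner_ext x y : (forall z, inner x z = inner y z) -> x = y.
Proof.
move=> h; apply/eqP; rewrite -subr_eq0; apply/eqP/rnorm_sqr_le0.
by rewrite -rdot_self /rdot innerBl h subrr.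
Qed.

Lemma inner_extr x y : (forall z, inner z x = inner z y) -> x = y.
Proof. by move=> h; apply: inner_ext => z; rewrite innerC h -innerC. Qed.

(** Rotating by [u] turns bounds on real parts into bounds on moduli. *)
Lemma phase (z : R[i]) : exists2 u : R[i], `|u| = 1 & u * z = `|z|.
Proof.
have [->|z0] := eqVneq z 0; first by exists 1; rewrite ?normr1 // normr0 mulr0.
exists (`|z| / z); last by rewrite divfK.
by rewrite normrM normfV normr_id divff // normr_eq0.
Qed.

Lemma cauchy_schwarz_rdot x y : rdot x y <= rnorm x * rnorm y.
Proof.
have [y0|y0] := eqVneq (rnorm y) 0.
  by rewrite y0 mulr0 (rnorm_eq0 y0) /rdot inner0r.
have py : 0 < rnorm y by rewrite lt_neqAle eq_sym y0 rnorm_ge0.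
(* The squared norm of |y| x - |x| y is 2 |x| |y| (|x| |y| - Re <x, y>); no division by a norm is
   involved. *)
have h0 := rdot_self ((rnorm y)%:C *: x - (rnorm x)%:C *: y).
have : 0 <= 2 * (rnorm x * rnorm y) * (rnorm x * rnorm y - rdot x y).
  have := sqr_ge0 (rnorm ((rnorm y)%:C *: x - (rnorm x)%:C *: y)).
  rewrite -h0 !rdotE !rdot_self (rdotC y x) => h.
  apply: (le_trans h); rewrite le_eqVlt; apply/orP; left; apply/eqP; ring.
have [x0|x0] := eqVneq (rnorm x) 0.
  by rewrite x0 mul0r (rnorm_eq0 x0) /rdot inner0l.
have px : 0 < rnorm x by rewrite lt_neqAle eq_sym x0 rnorm_ge0.
by rewrite pmulr_rge0 ?subr_ge0// !mulr_gt0.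
Qed.

Lemma cauchy_schwarz x y : `|inner x y| <= (rnorm x * rnorm y)%:C.
Proof.
have [u u1 uE] := phase (inner x y).
have := cauchy_schwarz_rdot (u *: x) y.
rewrite rnormZ u1 /= mul1r /rdot innerZl uE -lecR RRe_real ?normr_real//.
Qed.

End HilbertBasics.

(** * Convergence, closed sets and bounded operators through the real norm *)

Section Topology.
Context {R : realType} {H : hilbertType R}.
Implicit Types (x y z l : H) (u : nat -> H) (M : set H) (T : H -> H).

(** Convergence with a real epsilon; the R[i]-valued balls of the space are confined to
    [nbhs_rnormP] and [cauchy_tends]. *)
Definition tends u l : Prop :=
  forall e : R, 0 < e -> exists N, forall n, (N <= n)%N -> rnorm (u n - l) < e.

Lemma Re_gt0 (e : R[i]) : 0 < e -> (0 < complex.Re e) /\ e = (complex.Re e)%:C.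
Proof. by case: e => a b; rewrite ltcE /= => /andP[/eqP -> ->]. Qed.

Lemma nbhs_rnormP x (P : set H) :
  nbhs x P <-> exists2 e : R, 0 < e & forall y, rnorm (x - y) < e -> P y.
Proof.
rewrite nbhs_ballP; split=> [[e /= e0 eP]|[e e0 eP]].
  have [e0' eE] := Re_gt0 e0; exists (complex.Re e) => // y xy; apply: eP.
  by rewrite -ball_normE /ball_ /= rnormE eE ltcR.
exists e%:C; first by rewrite /= ltcR.
by move=> y; rewrite -ball_normE /ball_ /= rnormE ltcR; exact: eP.
Qed.

Lemma cauchy_tends u :
  (forall e : R, 0 < e -> exists N, forall m n, (N <= m)%N -> (N <= n)%N ->
     rnorm (u m - u n) < e) -> exists l, tends u l.
Proof.
move=> cu; have /cauchy_cvgP/cvg_ex[l ul] : cauchy (u @ \oo).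
  apply/cauchy_ballP => e /Re_gt0[e0 eE]; have [N uN] := cu _ e0.
  exists (u @` [set n | (N <= n)%N], u @` [set n | (N <= n)%N]).
    by split; exists N => //= n Nn; exists n.
  move=> [_ _] /= [[m Nm <-] [n Nn <-]].
  by rewrite -ball_normE /ball_ /= rnormE eE ltcR; apply: uN.
exists l => e e0; have := ul [set y | rnorm (l - y) < e].
case; first by apply/nbhs_rnormP; exists e.
by move=> N _ uN; exists N => n /uN /=; rewrite rnormBC.
Qed.

Lemma closed_rnormP M :
  closed M <-> forall x, (forall e : R, 0 < e -> exists2 y, M y & rnorm (x - y) < e) -> M x.
Proof.
split=> [cM x xM|h x xM].
  apply: cM => B /nbhs_rnormP[e e0 eB]; have [y My xy] := xM _ e0.
  by exists y; split => //; apply: eB.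
apply: h => e e0; have [|y [My xy]] := xM [set y | rnorm (x - y) < e].
  by apply/nbhs_rnormP; exists e.
by exists y.
Qed.

Lemma linD T : linear T -> {morph T : x y / x + y}.
Proof. by move=> lT x y; have := lT 1 x y; rewrite !scale1r. Qed.

Lemma lin0 T : linear T -> T 0 = 0.
Proof. by move=> lT; apply: (addIr (T 0)); rewrite -linD// !add0r. Qed.

Lemma linZ T : linear T -> forall a : R[i], {morph T : x / a *: x}.
Proof. by move=> lT a x; have := lT a x 0; rewrite !addr0 lin0// addr0. Qed.

Lemma linN T : linear T -> {morph T : x / - x}.
Proof. by move=> lT x; rewrite -scaleN1r linZ// scaleN1r. Qed.

Lemma linB T : linear T -> {morph T : x y / x - y}.
Proof. by move=> lT x y; rewrite linD// linN. Qed.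

Lemma bounded_opP T :
  bounded_op T <-> linear T /\ exists2 c : R, 0 <= c & forall x, rnorm (T x) <= c * rnorm x.
Proof.
split=> [[lT cT]|[lT [c c0 cT]]]; split=> //.
  have /nbhs_rnormP[d d0 dT] : nbhs 0 (T @^-1` [set y | rnorm y < 1]).
    apply: cT; apply/nbhs_rnormP; exists 1 => // y.
    by rewrite lin0// sub0r rnormN.
  (* A nonzero [x] is rescaled to norm d / 2, strictly inside the ball of radius [d] where |T| stays
     below 1. *)
  exists (2 / d); first by rewrite divr_ge0// ltW.
  move=> x; have [->|x0] := eqVneq x 0.
    by rewrite lin0// rnorm0 mulr0.
  have nx : 0 < rnorm x.
    rewrite lt_neqAle rnorm_ge0 andbT eq_sym; apply: contraNneq x0.
    by move/rnorm_eq0 ->.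
  have c0 : 0 < d / (2 * rnorm x) by rewrite divr_gt0// mulr_gt0.
  have := dT ((d / (2 * rnorm x))%:C *: x); rewrite sub0r rnormN rnormZR gtr0_norm//.
  have -> : d / (2 * rnorm x) * rnorm x = d / 2 by field; rewrite gt_eqF.
  have d2 : d / 2 < d by rewrite ltr_pdivrMr// ltr_pMr// ltr1n.
  move=> /(_ d2); rewrite /= linZ// rnormZR gtr0_norm// => h.
  have {h} := ltW h; rewrite -ler_pdivlMl// => /le_trans; apply.
  by rewrite mulr1 le_eqVlt; apply/orP; left; apply/eqP; field; rewrite !gt_eqF.
move=> x B /nbhs_rnormP[e e0 eB]; apply/nbhs_rnormP.
(* The bound [c] may be 0, hence the division by [c + 1]. *)
exists (e / (c + 1)); first by rewrite divr_gt0// ltr_wpDl.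
move=> y; rewrite ltr_pdivlMr ?ltr_wpDl// => xy; apply: eB.
rewrite -linB//; apply: (le_lt_trans (cT _)); apply: le_lt_trans xy.
by rewrite mulrC ler_wpM2l ?rnorm_ge0// lerDl.
Qed.

Lemma closed_subspace_ker T : bounded_op T -> closed_subspace (opker T).
Proof.
move=> /bounded_opP[lT [c c0 cT]]; split.
- apply/closed_rnormP => x hx; apply/rnorm_eq0/eqP; rewrite eq_le rnorm_ge0 andbT.
  apply/ler_addgt0Pr => e e0; rewrite add0r.
  have [|y Ty xy] := hx (e / (c + 1)); first by rewrite divr_gt0// ltr_wpDl.
  have -> : T x = T (x - y) by rewrite linB// Ty subr0.
  apply: (le_trans (cT _)); move: xy; rewrite ltr_pdivlMr ?ltr_wpDl// => /ltW; apply: le_trans.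
  by rewrite mulrC ler_wpM2l ?rnorm_ge0// lerDl.
- exact: lin0.
- by move=> a x y Tx Ty; rewrite /opker /= lT Tx Ty scaler0 addr0.
Qed.

Lemma closed_subspace_orthocomp M : closed_subspace (orthocomp M).
Proof.
split.
- apply/closed_rnormP => x hx z Mz; apply/eqP; rewrite -normr_eq0.
  have nE : `|inner x z| = (complex.Re `|inner x z|)%:C by rewrite RRe_real// normr_real.
  suff : complex.Re `|inner x z| <= 0.
    by rewrite nE eq_le !lecR => ->; rewrite -lecR -nE normr_ge0.
  apply/ler_addgt0Pr => e e0; rewrite add0r.
  have n1 : 0 < rnorm z + 1 by rewrite ltr_wpDl// rnorm_ge0.
  have [|y yM xy] := hx (e / (rnorm z + 1)); first by rewrite divr_gt0.
  rewrite -lecR -nE; have -> : inner x z = inner (x - y) z by rewrite innerBl (yM _ Mz) subr0.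
  apply: (le_trans (cauchy_schwarz _ _)); rewrite lecR.
  move: xy; rewrite ltr_pdivlMr// => /ltW; apply: le_trans.
  by rewrite ler_wpM2l ?rnorm_ge0// lerDl.
- by move=> y _; rewrite inner0l.
- by move=> a x y Mx My z Mz; rewrite innerDl innerZl Mx// My// mulr0 addr0.
Qed.

End Topology.

(** * Projections and adjoints *)

Section ProjectionAdjoint.
Context {R : realType} {H : hilbertType R}.
Implicit Types (x y z l : H) (u : nat -> H) (M : set H) (S T : H -> H).

Lemma subspaceD M x y : closed_subspace M -> M x -> M y -> M (x + y).
Proof. by move=> [_ _ cM] Mx My; rewrite -[x]scale1r; apply: cM. Qed.

Lemma subspaceZ M (a : R[i]) x : closed_subspace M -> M x -> M (a *: x).
Proof. by move=> [_ M0 cM] Mx; rewrite -[_ *: x]addr0; apply: cM. Qed.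

Lemma subspaceB M x y : closed_subspace M -> M x -> M y -> M (x - y).
Proof. by move=> cM Mx My; rewrite -scaleN1r; apply: subspaceD => //; apply: subspaceZ. Qed.

Lemma parallelogram x y :
  rnorm (x + y) ^+ 2 + rnorm (x - y) ^+ 2 = 2 * rnorm x ^+ 2 + 2 * rnorm y ^+ 2.
Proof. by rewrite rnormD_sqr rnormB_sqr; ring. Qed.

(** First-order condition at a minimum: if Re <x, y> were positive, a small step along [y] would
    shorten [x]. *)
Lemma rdot_le0_of_minimal x y :
  (forall t : R, rnorm x ^+ 2 <= rnorm (x - t%:C *: y) ^+ 2) -> rdot x y <= 0.
Proof.
move=> h; rewrite leNgt; apply/negP => d0.
have n0 : 0 <= rnorm y ^+ 2 by rewrite sqr_ge0.
(* Close to the optimal step Re <x, y> / |y|^2; the added 1 covers a zero [y]. *)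
pose t := rdot x y / (rnorm y ^+ 2 + 1).
have n1 : 0 < rnorm y ^+ 2 + 1 by rewrite ltr_wpDl.
have t0 : 0 < t by rewrite divr_gt0.
have tE : t * (rnorm y ^+ 2 + 1) = rdot x y by rewrite /t divfK// gt_eqF.
have := h t; rewrite rnormB_sqr rdotZr rnormZR exprMn -normrX ger0_norm ?sqr_ge0//.
rewrite -tE => {}h.
have : 0 <= - (t ^+ 2 * (rnorm y ^+ 2 + 2)) by lra.
rewrite oppr_ge0 leNgt mulr_gt0//; first by rewrite exprn_gt0.
by rewrite ltr_wpDl.
Qed.

(** With y, the subspace contains - y and i y, which kills the real part and then the imaginary
    part. *)
Lemma inner0_of_rdot_le0 M x : closed_subspace M ->
  (forall y, M y -> rdot x y <= 0) -> orthocomp M x.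
Proof.
move=> cM h y My.
have {}h z : M z -> rdot x z = 0.
  move=> Mz; apply/eqP; rewrite eq_le h//= -oppr_le0 -rdotNr h//.
  by rewrite -scaleN1r; apply: subspaceZ.
have h1 := h _ My; have h2 := h _ (subspaceZ 'i%C cM My).
move: h1 h2; rewrite /rdot innerZr; case: (inner x y) => a b /=.
by rewrite !mul0r sub0r mulN1r opprK => -> ->.
Qed.

(** A sequence in M minimizing the distance to [x] is Cauchy by the parallelogram law, since
    midpoints stay in M. At its limit the first-order condition gives orthogonality. *)
Lemma projection_exists M x : closed_subspace M ->
  exists y, M y /\ orthocomp M (x - y).
Proof.
move=> cM; have [clM M0 _] := cM.
pose E := [set rnorm (x - y) ^+ 2 | y in M].
have hE : has_inf E.
  by split; [exists (rnorm (x - 0) ^+ 2), 0 | exists 0 => _ [y _ <-]; exact: sqr_ge0].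
have dE y : M y -> inf E <= rnorm (x - y) ^+ 2.
  by move=> My; apply: ge_inf; [exact: hE.2 | exists y].
have [u uP] : {u : nat -> H & forall n, M (u n) /\ rnorm (x - u n) ^+ 2 < inf E + n.+1%:R^-1}.
  apply: (@choice _ _ (fun n v => M v /\ rnorm (x - v) ^+ 2 < inf E + n.+1%:R^-1)) => n.
  have e0 : 0 < n.+1%:R^-1 :> R by rewrite invr_gt0 ltr0n.
  have [_ [y My <-] yE] := inf_adherent e0 hE.
  by exists y.
have uu m n : rnorm (u m - u n) ^+ 2 <= 2 * m.+1%:R^-1 + 2 * n.+1%:R^-1.
  have [[Mm um] [Mn un]] := (uP m, uP n).
  have := parallelogram (x - u m) (x - u n).
  have -> : x - u m - (x - u n) = - (u m - u n) by rewrite opprB addrC addrA subrK opprB.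
  rewrite rnormN.
  have -> : x - u m + (x - u n) = (2 : R)%:C *: (x - (2^-1 : R)%:C *: (u m + u n)).
    rewrite scalerBr scalerA -rmorphM /= divff ?pnatr_eq0// scale1r.
    by rewrite rmorphD /= scalerDl scale1r opprD addrACA.
  rewrite rnormZR exprMn.
  have := dE _ (subspaceZ (2^-1 : R)%:C cM (subspaceD cM Mm Mn)).
  rewrite (ger0_norm (_ : 0 <= 2 :> R))//; move: um un.
  set a := rnorm (x - _) ^+ 2; set b := rnorm (x - u n) ^+ 2.
  set c := rnorm (u m - _) ^+ 2; set d := rnorm _ ^+ 2; set i := inf E.
  set p := m.+1%:R^-1; set q := n.+1%:R^-1; nra.
have [l ul] : exists l, tends u l.
  apply: cauchy_tends => e e0.
  pose N := Num.truncn (4 / e ^+ 2).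
  have e2 : 0 < e ^+ 2 by rewrite exprn_gt0.
  have hN n : (N <= n)%N -> 4 * n.+1%:R^-1 < e ^+ 2.
    move=> Nn; rewrite ltr_pdivrMr ?ltr0n// mulrC -ltr_pdivrMr//.
    by apply: (lt_le_trans (truncnS_gt _)); rewrite ler_nat ltnS.
  exists N => m n Nm Nn; rewrite -(@ltr_pXn2r _ 2)// ?nnegrE ?rnorm_ge0 ?ltW//.
  apply: (le_lt_trans (uu m n)); move: (hN m Nm) (hN n Nn).
  by move: (m.+1%:R^-1) (n.+1%:R^-1) => p q; lra.
have Ml : M l.
  apply: (closed_rnormP M).1 => // e e0; have [N uN] := ul _ e0.
  by exists (u N); [exact: (uP N).1 | rewrite rnormBC; apply: uN].
have lE : rnorm (x - l) ^+ 2 <= inf E.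
  have lt0 : 0 <= rnorm (x - l) by exact: rnorm_ge0.
  apply/ler_addgt0Pr => e e0.
  have c0 : 0 < 2 * rnorm (x - l) + 1 by lra.
  (* Being within [d] of the limit changes the squared distance by at most e / 2; the other e / 2
     absorbs the 1 / (n + 1) of the minimizing sequence. *)
  pose d := Num.min 1 (e / 2 / (2 * rnorm (x - l) + 1)).
  have d0 : 0 < d by rewrite lt_min ltr01 !divr_gt0.
  have d1 : d <= 1 by rewrite ge_min lexx.
  have dd : d * (2 * rnorm (x - l) + 1) <= e / 2.
    by rewrite -ler_pdivlMr// ge_min lexx orbT.
  have [N uN] := ul _ d0; pose n := maxn N (Num.truncn (2 / e)).
  have en : n.+1%:R^-1 < e / 2.
    rewrite invf_plt ?posrE ?ltr0n ?divr_gt0// invf_div.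
    apply: (lt_le_trans (truncnS_gt _)).
    by rewrite ler_nat ltnS leq_maxr.
  have := (uP n).2; have := uN n (leq_maxl _ _).
  have := rnorm_triangleB x (u n) l.
  move: en lt0 (rnorm_ge0 (x - u n)) (rnorm_ge0 (u n - l)) dd.
  set a := rnorm (x - l); set b := rnorm (x - u n); set c := rnorm (u n - l).
  set p := n.+1%:R^-1; set i := inf E => en a0 b0 c1 dd ab cd bi.
  have : (a - d) ^+ 2 <= b ^+ 2 \/ a <= d.
    have [ad|ad] := leP a d; [by right|left].
    by rewrite ler_pXn2r// ?nnegrE; lra.
  have i0 : 0 <= i.
    by apply: lb_le_inf; [exact: hE.1 | move=> _ [y _ <-]; exact: sqr_ge0].
  have := sqr_ge0 d; case=> ?; nra.
exists l; split=> //; apply: (inner0_of_rdot_le0 cM) => y My.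
apply: rdot_le0_of_minimal => t; apply: (le_trans lE).
have -> : x - l - t%:C *: y = x - (l + t%:C *: y) by rewrite opprD addrA.
by apply: dE; apply: subspaceD => //; apply: subspaceZ.
Qed.

End ProjectionAdjoint.

(** * Riesz representation, adjoints, contractions and orthogonal projections *)

Section Adjoint.
Context {R : realType} {H : hilbertType R}.
Implicit Types (x y z : H) (M : set H) (S T U : H -> H).

Lemma rnorm_mono (a b : R) : 0 <= b -> a ^+ 2 <= b ^+ 2 -> a <= b.
Proof. by move=> b0 h; rewrite leNgt; apply/negP => ba; nra. Qed.

Lemma orthprojP M x : closed_subspace M -> M (orthproj M x) /\ orthocomp M (x - orthproj M x).
Proof.
move=> cM; have /choice[P hP] x' := projection_exists x' cM.
have := @xgetPex _ (0 : H -> H) [set P | forall x, M (P x) /\ orthocomp M (x - P x)].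
by apply; exists P.
Qed.

Lemma orthproj_unique M x y : closed_subspace M -> M y -> orthocomp M (x - y) ->
  orthproj M x = y.
Proof.
move=> cM My xy; have [MP xP] := orthprojP x cM.
apply/eqP; rewrite -subr_eq0; apply/eqP/rnorm_sqr_le0.
set d := _ - _; have Md : M d by apply: subspaceB.
have -> : rnorm d ^+ 2 = rdot ((x - y) - (x - orthproj M x)) d.
  by rewrite opprB addrC addrA subrK rdot_self.
by rewrite /rdot innerBl xy// xP// subrr.
Qed.

(** A vector z orthogonal to the kernel of [f] with f z nonzero represents [f] up to a scalar,
    because f(x) z - f(z) x lies in the kernel. *)
Lemma riesz (f : H -> R[i]) (c : R) : scalar f ->
  (forall x, `|f x| <= (c * rnorm x)%:C) -> exists y, forall x, f x = inner x y.
Proof.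
move=> lf fc.
have f0 : f 0 = 0 by have := fc 0; rewrite rnorm0 mulr0 normr_le0 => /eqP.
have fB x y : f (x - y) = f x - f y by rewrite addrC -scaleN1r lf mulN1r addrC.
have cM : closed_subspace [set x | f x = 0].
  split => //=; last by move=> a x y /= fx fy; rewrite lf fx fy mulr0 addr0.
  apply/closed_rnormP => x hx /=; apply/eqP; rewrite -normr_le0.
  have nE : `|f x| = (complex.Re `|f x|)%:C by rewrite RRe_real// normr_real.
  rewrite nE lecR; apply/ler_addgt0Pr => e e0; rewrite add0r.
  have c1 : 0 < `|c| + 1 by rewrite ltr_wpDl.
  have [|y fy xy] := hx (e / (`|c| + 1)); first by rewrite divr_gt0.
  rewrite -lecR -nE; have -> : f x = f (x - y) by rewrite fB fy subr0.
  apply: (le_trans (fc _)); rewrite lecR; move: xy; rewrite ltr_pdivlMr// => /ltW.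
  apply: le_trans; rewrite mulrC; apply: ler_wpM2l; rewrite ?rnorm_ge0//.
  by have := ler_norm c; lra.
have [fN0|] := pselect (forall x, f x = 0).
  by exists 0 => x; rewrite inner0r.
move=> /existsNP[x0 /eqP fx0].
have [/= fP xP] := orthprojP x0 cM.
set z := x0 - _ in xP; have fz : f z = f x0 by rewrite fB fP subr0.
have nz : inner z z != 0.
  apply: contraNneq fx0; rewrite inner_self -(rmorph0 (real_complex R)) => /complexI z0.
  by rewrite -fz (@rnorm_sqr_le0 _ _ z) ?z0// f0.
exists ((f z / inner z z)^*%R *: z) => x; rewrite innerZr conjCK.
have /xP : f (f x *: z - f z *: x) = 0.
  by rewrite addrC -scaleNr lf -[f x *: z]addr0 lf f0 addr0 mulNr [f z * _]mulrC addNr.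
rewrite innerC => /eqP; rewrite conjC_eq0 innerBl !innerZl subr_eq0 => /eqP h.
by rewrite mulrAC -h mulfK.
Qed.

Lemma adjoint_exists T : bounded_op T ->
  exists S, bounded_op S /\ forall x y, inner (T x) y = inner x (S y).
Proof.
move=> /bounded_opP[lT [c c0 cT]].
have /choice[S hS] : forall y, exists z, forall x, inner (T x) y = inner x z.
  move=> y; apply: (@riesz _ (c * rnorm y)) => [a u v|x]; first by rewrite lT innerDl innerZl.
  apply: (le_trans (cauchy_schwarz _ _)); rewrite lecR mulrAC.
  by rewrite ler_wpM2r ?rnorm_ge0.
exists S; split => //; apply/bounded_opP; split.
  by move=> a u v; apply: inner_extr => z; rewrite !innerE -!hS !innerE.
exists c => // y; have [->|S0] := eqVneq (rnorm (S y)) 0; first by rewrite mulr_ge0 ?rnorm_ge0.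
have S1 : 0 < rnorm (S y) by rewrite lt_neqAle eq_sym S0 rnorm_ge0.
rewrite -(ler_pM2l S1) -expr2 -rdot_self /rdot -hS.
apply: (le_trans (cauchy_schwarz_rdot _ _)); rewrite mulrCA mulrA.
by rewrite ler_wpM2r ?rnorm_ge0.
Qed.

Lemma adjopP T : bounded_op T ->
  bounded_op (adjop T) /\ forall x y, inner (T x) y = inner x (adjop T y).
Proof. by move=> /adjoint_exists h; exact: (xgetPex (0 : H -> H) h). Qed.

Lemma bounded_adj T : bounded_op T -> bounded_op (adjop T).
Proof. by move=> /adjopP[]. Qed.

Lemma adjE T x y : bounded_op T -> inner (T x) y = inner x (adjop T y).
Proof. by move=> /adjopP[]. Qed.

Lemma adjEr T x y : bounded_op T -> inner (adjop T x) y = inner x (T y).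
Proof. by move=> bT; rewrite innerC -adjE// -innerC. Qed.

Lemma adj_unique T S : bounded_op T ->
  (forall x y, inner (T x) y = inner x (S y)) -> adjop T = S.
Proof.
by move=> bT h; apply/funext => y; apply: inner_extr => x; rewrite -adjE// h.
Qed.

Lemma adjK T : bounded_op T -> adjop (adjop T) = T.
Proof.
by move=> bT; apply: adj_unique => [|x y]; [exact: bounded_adj|rewrite adjEr].
Qed.

Lemma bounded_lin T : bounded_op T -> linear T.
Proof. by case. Qed.

Lemma bounded_comp S T : bounded_op S -> bounded_op T -> bounded_op (S \o T).
Proof.
move=> /bounded_opP[lS [c c0 cS]] /bounded_opP[lT [d d0 dT]]; apply/bounded_opP.
split; first by move=> a x y /=; rewrite lT lS.
exists (c * d) => [|x]; first exact: mulr_ge0.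
by apply: (le_trans (cS _)); rewrite -mulrA ler_wpM2l.
Qed.

Lemma boundedD S T : bounded_op S -> bounded_op T -> bounded_op (S + T).
Proof.
move=> /bounded_opP[lS [c c0 cS]] /bounded_opP[lT [d d0 dT]]; apply/bounded_opP.
split; first by move=> a x y; rewrite !fctE lT lS scalerDr addrACA.
exists (c + d) => [|x]; first exact: addr_ge0.
by apply: (le_trans (rnorm_triangle _ _)); rewrite mulrDl lerD.
Qed.

Lemma boundedZ (a : R[i]) T : bounded_op T -> bounded_op (a *: T).
Proof.
move=> /bounded_opP[lT [d d0 dT]]; apply/bounded_opP.
split; first by move=> b x y; rewrite !fctE lT scalerDr !scalerA mulrC.
have a0 : 0 <= complex.Re `|a| by rewrite -ler0c RRe_real ?normr_real.
exists (complex.Re `|a| * d) => [|x]; first exact: mulr_ge0.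
by rewrite fctE rnormZ -mulrA ler_wpM2l.
Qed.

Lemma boundedB S T : bounded_op S -> bounded_op T -> bounded_op (S - T).
Proof. by move=> bS bT; rewrite -scaleN1r; apply: boundedD => //; apply: boundedZ. Qed.

Lemma bounded_id : bounded_op (@id H).
Proof. by apply/bounded_opP; split => //; exists 1 => // x; rewrite mul1r. Qed.

Lemma bounded0 : bounded_op (0 : H -> H).
Proof.
apply/bounded_opP; split; first by move=> a x y; rewrite [LHS]/(0 : H) scaler0 addr0.
by exists 0 => // x; rewrite mul0r [_ x]/(0 : H) rnorm0.
Qed.

Lemma adj_comp S T : bounded_op S -> bounded_op T ->
  adjop (S \o T) = adjop T \o adjop S.
Proof.
by move=> bS bT; apply: adj_unique => [|x y]; [exact: bounded_comp|rewrite /= !adjE].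
Qed.

Lemma adjD S T : bounded_op S -> bounded_op T -> adjop (S + T) = adjop S + adjop T.
Proof.
move=> bS bT; apply: adj_unique => [|x y]; first exact: boundedD.
by rewrite !fctE innerDl innerDr !adjE.
Qed.

Lemma adjZ (a : R[i]) T : bounded_op T -> adjop (a *: T) = a^*%R *: adjop T.
Proof.
move=> bT; apply: adj_unique => [|x y]; first exact: boundedZ.
by rewrite !fctE innerZl innerZr conjCK adjE.
Qed.

Lemma adjB S T : bounded_op S -> bounded_op T -> adjop (S - T) = adjop S - adjop T.
Proof.
move=> bS bT; rewrite -scaleN1r adjD ?adjZ//; last exact: boundedZ.
by rewrite rmorphN1 scaleN1r.
Qed.

Lemma adj_id : adjop (@id H) = id.
Proof. by apply: adj_unique => //; exact: bounded_id. Qed.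

Definition contractive T : Prop := bounded_op T /\ forall x, rnorm (T x) <= rnorm x.

Lemma contractive_bounded T : contractive T -> bounded_op T. Proof. by case. Qed.

Lemma contractive_comp S T : contractive S -> contractive T -> contractive (S \o T).
Proof.
move=> [bS cS] [bT cT]; split; first exact: bounded_comp.
by move=> x /=; apply: (le_trans (cS _)).
Qed.

Lemma contractive_adj T : contractive T -> contractive (adjop T).
Proof.
move=> [bT cT]; split; first exact: bounded_adj.
move=> x; rewrite leNgt; apply/negP => xT.
have := cauchy_schwarz_rdot (T (adjop T x)) x; rewrite {1}/rdot adjE// -/(rdot _ _).
rewrite rdot_self; apply/negP; rewrite -ltNge expr2.
apply: (@le_lt_trans _ _ (rnorm (adjop T x) * rnorm x)).
  by rewrite ler_wpM2r ?rnorm_ge0.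
by rewrite ltr_pM2l// (le_lt_trans _ xT)// rnorm_ge0.
Qed.

Lemma contractiveZ (a : R[i]) T : `|a| <= 1 -> contractive T -> contractive (a *: T).
Proof.
move=> a1 [bT cT]; split; first exact: boundedZ.
move=> x; rewrite fctE rnormZ; apply: le_trans (cT x).
by rewrite ler_piMl ?rnorm_ge0// -lecR RRe_real ?normr_real.
Qed.

(* |T*T x - x|^2 <= |x|^2 - 2 Re <T*T x, x> + |x|^2 = 0 *)
Lemma contractive_isometric T x : contractive T -> rnorm (T x) = rnorm x ->
  adjop T (T x) = x.
Proof.
move=> cT Tx; apply/eqP; rewrite -subr_eq0; apply/eqP/rnorm_sqr_le0.
rewrite rnormB_sqr {1}/rdot adjEr; last by case: cT.
have [_ /(_ (T x))] := contractive_adj cT.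
rewrite -/(rdot _ _) rdot_self Tx; have := rnorm_ge0 x.
by have := rnorm_ge0 (adjop T (T x)); nra.
Qed.

(** Equality case of Cauchy-Schwarz: |T x - x|^2 = |T x|^2 - |x|^2 <= 0. In [optr_contractive] it
    turns an equality of traces into one of operators. *)
Lemma contractive_fixed T x : contractive T -> rdot (T x) x = rnorm x ^+ 2 -> T x = x.
Proof.
move=> cT Tx; apply/eqP; rewrite -subr_eq0; apply/eqP/rnorm_sqr_le0.
rewrite rnormB_sqr Tx; have [_ /(_ x)] := cT.
by have := rnorm_ge0 (T x); have := rnorm_ge0 x; nra.
Qed.

Section Orthproj.
Variables (M : set H) (cM : closed_subspace M).
Let P := orthproj M.

Lemma orthproj_mem x : M (P x). Proof. exact: (orthprojP x cM).1. Qed.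

Lemma orthproj_id x : M x -> P x = x.
Proof.
by move=> Mx; apply: orthproj_unique => //; rewrite subrr => y _; rewrite inner0l.
Qed.

Lemma orthproj_pythagoras x : rnorm (P x) ^+ 2 + rnorm (x - P x) ^+ 2 = rnorm x ^+ 2.
Proof.
have [MP xP] := orthprojP x cM.
have -> : rnorm x ^+ 2 = rnorm (x - P x + P x) ^+ 2 by rewrite subrK.
by rewrite [RHS]rnormD_sqr /rdot xP//= mulr0 addr0 addrC.
Qed.

Lemma orthproj_contractive : contractive P.
Proof.
have nP x : rnorm (P x) <= rnorm x.
  apply: rnorm_mono; first exact: rnorm_ge0.
  by rewrite -(orthproj_pythagoras x) lerDl sqr_ge0.
split=> //; apply/bounded_opP; split; last by exists 1 => // x; rewrite mul1r.
move=> a x y; have [Mx xP] := orthprojP x cM; have [My yP] := orthprojP y cM.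
apply: orthproj_unique => //; first by apply: subspaceD => //; apply: subspaceZ.
rewrite opprD addrACA -scalerBr => z Mz.
by rewrite innerDl innerZl xP// yP// mulr0 addr0.
Qed.

Lemma orthproj_adj : adjop P = P.
Proof.
apply: adj_unique => [|x y]; first by case: orthproj_contractive.
have [Mx xP] := orthprojP x cM; have [My yP] := orthprojP y cM.
have h : inner (P x) (y - P y) = 0 by rewrite innerC yP// conjC0.
have k : inner (x - P x) (P y) = 0 by rewrite xP.
move: h k; rewrite innerBr innerBl => /eqP; rewrite subr_eq0 => /eqP -> /eqP.
by rewrite subr_eq0 => /eqP ->.
Qed.

Lemma orthproj_orth x : orthocomp M x -> P x = 0.
Proof.
move=> Mx; apply: orthproj_unique => //; last by rewrite subr0.
by case: cM.
Qed.

Lemma orthproj_compl x : orthproj (orthocomp M) x = x - P x.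
Proof.
have [Mx xP] := orthprojP x cM; apply: orthproj_unique => //.
  exact: closed_subspace_orthocomp.
by rewrite subKr => y yM; rewrite innerC yM// conjC0.
Qed.

End Orthproj.

(** T sees only the component of x orthogonal to its kernel, which is no longer than x. *)
Lemma partial_isometry_contractive T : partial_isometry T -> contractive T.
Proof.
move=> [bT iT]; split=> // x; have cK := closed_subspace_ker bT.
have [/= KP xP] := orthprojP x cK.
have lT := bounded_lin bT.
have -> : T x = T (x - orthproj (opker T) x) by rewrite linB// KP subr0.
rewrite /rnorm iT// -/(rnorm _); apply: rnorm_mono; first exact: rnorm_ge0.
by rewrite -(orthproj_pythagoras cK x) lerDr sqr_ge0.
Qed.

End Adjoint.

(** * Square roots, absolute values and polar decompositions *)

Section SquareRoot.
Context {R : realType} {H : hilbertType R}.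
Implicit Types (x y z : H) (S T P C : H -> H).

Lemma rdot_adj T x y : bounded_op T -> rdot (T x) y = rdot x (adjop T y).
Proof. by move=> bT; rewrite /rdot adjE. Qed.

Lemma inv_mul_lt (c e : R) n : 0 < e -> (Num.truncn (c / e) <= n)%N -> n.+1%:R^-1 * c < e.
Proof.
move=> e0 en; rewrite ltr_pdivrMl ?ltr0n// -ltr_pdivrMr//.
by apply: (lt_le_trans (truncnS_gt _)); rewrite ler_nat.
Qed.

(** Algebraic identities pass to the limit of the iteration below through bounds of this shape. *)
Lemma approx_eq x y (c : R) : (forall n : nat, rnorm (x - y) <= n.+1%:R^-1 * c) -> x = y.
Proof.
move=> h; apply/eqP; rewrite -subr_eq0; apply/eqP/rnorm_eq0/eqP.
rewrite eq_le rnorm_ge0 andbT; apply/ler_addgt0Pr => e e0; rewrite add0r.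
apply: (le_trans (h (Num.truncn (c / e)))); exact/ltW/inv_mul_lt.
Qed.

(** Polarization over the complex numbers, with the hypothesis taken at x + y and at x + i y. *)
Lemma selfadjoint_of_real T : bounded_op T ->
  (forall x, inner (T x) x = inner x (T x)) -> adjop T = T.
Proof.
move=> bT h; apply: adj_unique => // x y; have lT := bounded_lin bT.
have h1 := h (x + y); have h2 := h (x + 'i%C *: y).
move: h1 h2; rewrite !linD// linZ// !innerE !h.
have iJ : ('i%C : R[i])^*%R = - 'i%C by apply/eqP; rewrite eq_complex /= oppr0 !eqxx.
have i2 : ('i%C : R[i]) * 'i%C = -1 by rewrite -expr2 sqr_i.
rewrite iJ; move: ('i%C : R[i]) i2 => i i2; set a := inner x (T x); set b := inner y (T y).
set p := inner (T x) y; set q := inner (T y) x.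
set r := inner x (T y); set s := inner y (T x) => h1 h2.
move: h1 h2 => /eqP; rewrite -subr_eq0 => /eqP h1 /eqP.
rewrite -subr_eq0 => /eqP h2.
have e1 : p + q = r + s by apply/eqP; rewrite -subr_eq0 -h1; apply/eqP; ring.
have e2 : q - p = s - r.
  have : i * (q - p - (s - r)) = 0 by rewrite -h2; ring.
  move/(congr1 (fun w => i * w)); rewrite mulrA i2 mulN1r mulr0 => /eqP.
  by rewrite oppr_eq0 subr_eq0 => /eqP.
have : 2%:R * p = 2%:R * r.
  have -> : 2%:R * p = (p + q) - (q - p) by ring.
  by rewrite e1 e2; ring.
by apply: mulfI; rewrite pnatr_eq0.
Qed.

Lemma positive_adj P : positive_op P -> adjop P = P.
Proof.
move=> [bP pP]; apply: selfadjoint_of_real => // x.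
by rewrite [RHS]innerC; apply/esym/CrealP/ger0_real/pP.
Qed.

Lemma positive_opP P :
  positive_op P <-> [/\ bounded_op P, adjop P = P & forall x, 0 <= rdot (P x) x].
Proof.
split=> [pP|[bP sP pP]].
  split; [by case: pP|exact: positive_adj|move=> x].
  by have [_ /(_ x)] := pP; rewrite lecE => /andP[].
split=> // x; rewrite lecE pP andbT /=.
have : inner (P x) x = (inner (P x) x)^*%R by rewrite -innerC adjE// sP.
by case: (inner _ _) => a b [] /eqP; rewrite -addr_eq0 -mulr2n mulrn_eq0 => /eqP ->.
Qed.

Lemma positive_bounded P : positive_op P -> bounded_op P. Proof. by case. Qed.

Lemma positive_rdot_ge0 P x : positive_op P -> 0 <= rdot (P x) x.
Proof. by move=> /positive_opP[]. Qed.

Lemma positive_rdotC P x y : positive_op P -> rdot (P x) y = rdot x (P y).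
Proof. by move=> pP; rewrite rdot_adj ?positive_adj//; case: pP. Qed.

(* Expand 0 <= <B (x - B x), x - B x> *)
Lemma positive_contractive B : positive_op B ->
  (forall x, rdot (B x) x <= rnorm x ^+ 2) ->
  (forall x, rnorm (B x) ^+ 2 <= rdot (B x) x) /\ contractive B.
Proof.
move=> pB B1; have bB := positive_bounded pB.
have h x : rnorm (B x) ^+ 2 <= rdot (B x) x.
  have := positive_rdot_ge0 (x - B x) pB; have := B1 (B x).
  rewrite (linB (bounded_lin bB)) !rdotE (positive_rdotC (B x) x pB) !rdot_self.
  lra.
split=> //; split=> // x; have := h x; have := cauchy_schwarz_rdot (B x) x.
have := rnorm_ge0 x; have := rnorm_ge0 (B x).
set a := rnorm (B x); set b := rnorm x => a0 b0 h1 h2.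
have h3 := le_trans h2 h1; rewrite leNgt; apply/negP => ab.
by move: h3; apply/negP; rewrite -ltNge expr2 ltr_pM2l// (le_lt_trans b0).
Qed.

Lemma positiveZ (t : R) P : 0 <= t -> positive_op P -> positive_op (t%:C *: P).
Proof.
move=> t0 [bP pP]; split; first exact: boundedZ.
by move=> x; rewrite fctE innerZl mulr_ge0// ler0c.
Qed.

Lemma positiveD S P : positive_op S -> positive_op P -> positive_op (S + P).
Proof.
move=> [bS pS] [bP pP]; split; first exact: boundedD.
by move=> x; rewrite fctE innerDl addr_ge0.
Qed.

Lemma positive_scaled P : positive_op P -> exists2 k : R, 0 < k &
  forall x, rdot (k^-1%:C *: P x) x <= rnorm x ^+ 2.
Proof.
move=> pP; have /bounded_opP[lP [c c0 cP]] := positive_bounded pP.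
exists (c + 1) => [|x]; first by rewrite ltr_wpDl.
rewrite rdotZl ler_pdivrMl ?ltr_wpDl//.
apply: (le_trans (cauchy_schwarz_rdot _ _)); rewrite expr2 mulrA.
rewrite ler_wpM2r ?rnorm_ge0//; apply: (le_trans (cP x)).
by rewrite ler_wpM2r ?rnorm_ge0// lerDl.
Qed.

(** A multiple B of P below the identity satisfies |B x|^2 <= Re <B x, x>. *)
Lemma positive_rdot0 P x : positive_op P -> rdot (P x) x = 0 -> P x = 0.
Proof.
move=> pP Px; have [k k0 kP] := positive_scaled pP.
have pk : positive_op (k^-1%:C *: P) by apply: positiveZ; rewrite ?invr_ge0 ?ltW.
have [/(_ x) h _] := positive_contractive pk kP; move: h.
rewrite fctE rdotZl Px mulr0 => /rnorm_sqr_le0 /eqP; rewrite scaler_eq0 => /orP[|/eqP//].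
by rewrite -(rmorph0 (real_complex R)) => /eqP/complexI/eqP; rewrite invr_eq0 gt_eqF.
Qed.

(* Newton's iteration for 1 - sqrt (1 - B); its scalar version for B = 1 is a
   majorant, which yields convergence in norm without any use of the order. *)
Fixpoint newton (B : H -> H) n : H -> H :=
  if n is m.+1 then (2^-1 : R)%:C *: (B + (newton B m \o newton B m)) else 0.

Fixpoint newton1 n : R := if n is m.+1 then 2^-1 * (1 + newton1 m ^+ 2) else 0.

(** The error s = 1 - [newton1 n] evolves by s - s^2 / 2, hence decays like 2 / n. The explicit rate
    is what makes the operator iterates Cauchy with a known bound. *)
Lemma newton1_bounds n :
  [/\ 0 <= newton1 n, newton1 n <= newton1 n.+1, newton1 n <= 1
    & 1 - newton1 n <= 2 * n.+1%:R^-1].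
Proof.
elim: n => [|n [t0 t1 t2 t3]].
  by rewrite /= invr1 expr0n addr0 !mulr1 subr0 lexx ler01 ler1n invr_ge0 ler0n.
have tS : newton1 n.+2 = 2^-1 * (1 + newton1 n.+1 ^+ 2) by [].
have tS' : newton1 n.+1 = 2^-1 * (1 + newton1 n ^+ 2) by [].
have q0 : 0 <= newton1 n ^+ 2 <= 1 by rewrite sqr_ge0 exprn_ile1.
have u0 : 0 <= newton1 n.+1 <= 1 by rewrite tS'; move: q0; lra.
split; [by case/andP: u0| |by case/andP: u0|].
  by rewrite tS tS'; have := sqr_ge0 (1 - newton1 n.+1); rewrite tS'; nra.
rewrite tS'; move: t3; set t := newton1 n in t0 t1 t2 q0 *.
have n0 : 0 < n.+1%:R :> R by rewrite ltr0n.
rewrite -[n.+2]addn1 natrD; move: n0; set m := n.+1%:R => m0 t3.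
have m1 : 1 <= m by rewrite /m ler1n.
rewrite ler_pdivlMr; last lra.
move: t3; rewrite ler_pdivlMr// => t3.
have s0 : 0 <= 1 - t by lra.
move: s0 t3; have -> : t = 1 - (1 - t) by ring.
set s := 1 - t => s0; rewrite subKr => t3.
(* If s is already at most 2 / (m + 1), it only decreases. Otherwise s^2 (m + 1) >= 2 s, so the new
   error times m + 1 is at most s m <= 2. *)
have [s1|s1] := leP (s * (m + 1)) 2; first by nra.
have : s ^+ 2 * (m + 1) >= 2 * s by nra.
by nra.
Qed.

Section Newton.
Variables (B : H -> H) (cB : contractive B) (sB : adjop B = B).
Local Notation Y := (newton B).
Local Notation t := newton1.

Let bB : bounded_op B. Proof. exact: contractive_bounded. Qed.

Lemma newtonS n x : Y n.+1 x = (2^-1 : R)%:C *: (B x + Y n (Y n x)).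
Proof. by []. Qed.

Lemma newton_bounded n : bounded_op (Y n).
Proof.
elim: n => [|n IH]; first exact: bounded0.
by apply: boundedZ; apply: boundedD => //; apply: bounded_comp.
Qed.

Lemma newton_norm n x : rnorm (Y n x) <= t n * rnorm x.
Proof.
elim: n x => [|n IH] x; first by rewrite mul0r [_ x]/(0 : H) rnorm0.
have [t0 _ _ _] := newton1_bounds n.
rewrite newtonS rnormZR ger0_norm ?invr_ge0//.
rewrite [t n.+1]/(2^-1 * (1 + t n ^+ 2)) -mulrA ler_pM2l ?invr_gt0// mulrDl mul1r.
apply: (le_trans (rnorm_triangle _ _)); apply: lerD; first by case: cB.
by apply: (le_trans (IH _)); rewrite expr2 -mulrA ler_wpM2l.
Qed.

Lemma newton_step n x : rnorm (Y n.+1 x - Y n x) <= (t n.+1 - t n) * rnorm x.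
Proof.
elim: n x => [|n IH] x.
  rewrite [Y 0%N x]/(0 : H) subr0 subr0; exact: newton_norm.
have [t0 t1 _ _] := newton1_bounds n.
rewrite (newtonS n.+1) {2}(newtonS n x).
rewrite -scalerBr opprD addrACA subrr add0r rnormZR ger0_norm ?invr_ge0//.
have -> : t n.+2 - t n.+1 = 2^-1 * ((t n.+1 + t n) * (t n.+1 - t n)).
  have tS : t n.+2 = 2^-1 * (1 + t n.+1 ^+ 2) by [].
  have tS' : t n.+1 = 2^-1 * (1 + t n ^+ 2) by [].
  by rewrite tS {2}tS'; ring.
rewrite -mulrA ler_pM2l ?invr_gt0//.
have lY := bounded_lin (newton_bounded n).
(* Y'^2 - Y^2 = (Y' - Y) Y' + Y (Y' - Y) for consecutive iterates Y and Y', a splitting valid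
   without commutation and mirrored by the scalar factorization. *)
apply: (le_trans (rnorm_triangleB _ (Y n (Y n.+1 x)) _)).
have -> : (t n.+1 + t n) * (t n.+1 - t n) * rnorm x =
    (t n.+1 - t n) * (t n.+1 * rnorm x) + t n * ((t n.+1 - t n) * rnorm x) by ring.
apply: lerD; first by apply: (le_trans (IH _)); rewrite ler_wpM2l ?subr_ge0// newton_norm.
by rewrite -linB//; apply: (le_trans (newton_norm _ _)); rewrite ler_wpM2l.
Qed.

Lemma newton_cauchy m n x : (n <= m)%N ->
  rnorm (Y m x - Y n x) <= 2 * n.+1%:R^-1 * rnorm x.
Proof.
move=> nm; apply: (@le_trans _ _ ((t m - t n) * rnorm x)).
  rewrite -(subnKC nm); elim: (m - n)%N => [|k IH].
    by rewrite addn0 !subrr rnorm0 mul0r.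
  apply: (le_trans (rnorm_triangleB _ (Y (n + k) x) _)).
  rewrite addnS; apply: le_trans (lerD (newton_step _ _) IH) _.
  by rewrite -mulrDl addrA subrK.
rewrite ler_wpM2r ?rnorm_ge0//; have [_ _ t1 _] := newton1_bounds m.
by have [_ _ _ ] := newton1_bounds n; rewrite -/t; apply: le_trans; rewrite lerB.
Qed.

Lemma newton_limit_exists x : exists l, forall n, rnorm (l - Y n x) <= 2 * n.+1%:R^-1 * rnorm x.
Proof.
have [l lP] : exists l, tends (Y^~ x) l.
  apply: cauchy_tends => e e0.
  have hN n : (Num.truncn (2 * rnorm x / e) <= n)%N -> 2 * n.+1%:R^-1 * rnorm x < e.
    by move=> Nn; rewrite -mulrA mulrCA inv_mul_lt.
  exists (Num.truncn (2 * rnorm x / e)) => m n Nm Nn.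
  have [nm|/ltnW mn] := leqP n m; last rewrite rnormBC.
    by apply: le_lt_trans (hN n Nn); apply: newton_cauchy.
  by apply: le_lt_trans (hN m Nm); apply: newton_cauchy.
exists l => n; apply/ler_addgt0Pr => e e0; have [N NP] := lP e e0.
apply: (le_trans (rnorm_triangleB _ (Y (maxn N n) x) _)).
rewrite addrC lerD ?newton_cauchy ?leq_maxr//.
by rewrite rnormBC ltW// NP// leq_maxl.
Qed.

Lemma newton_adj n : adjop (Y n) = Y n.
Proof.
have h x y : inner (Y n x) y = inner x (Y n y).
  elim: n x y => [|n IH] x y; first by rewrite ![Y _ _]/(0 : H) inner0l inner0r.
  rewrite !newtonS !innerE !IH adjE// sB.
  by congr (_ * _); apply/esym/CrealP/ger0_real; rewrite ler0c invr_ge0.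
exact: adj_unique (newton_bounded n) h.
Qed.

(** The fixed-point equation 2 Z = B + Z^2 means (1 - Z)^2 = 1 - B. The last clause, inherited from
    the iterates, is the source of the uniqueness of square roots. *)
Lemma newton_limit : exists Z, [/\ contractive Z, adjop Z = Z,
  forall x, Z x + Z x = B x + Z (Z x) &
  forall C, bounded_op C -> C \o B = B \o C -> C \o Z = Z \o C].
Proof.
have /choice[Z ZP] := newton_limit_exists.
have lY n := bounded_lin (newton_bounded n).
have YP n x : rnorm (Y n x) <= rnorm x.
  apply: (le_trans (newton_norm _ _)); rewrite -[leRHS]mul1r ler_wpM2r ?rnorm_ge0//.
  by have [] := newton1_bounds n.
have ZP' n x : rnorm (Y n x - Z x) <= n.+1%:R^-1 * (2 * rnorm x).
  by rewrite rnormBC; apply: (le_trans (ZP x n)); rewrite -mulrA mulrCA.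
have {}ZP n x : rnorm (Z x - Y n x) <= n.+1%:R^-1 * (2 * rnorm x).
  by rewrite rnormBC.
have lZ : linear Z.
  move=> a x y; apply: (@approx_eq _ _ (2 * rnorm (a *: x + y) +
    (complex.Re `|a| * (2 * rnorm x) + 2 * rnorm y))) => n.
  apply: (le_trans (rnorm_triangleB _ (Y n (a *: x + y)) _)).
  rewrite mulrDr lerD//; rewrite lY opprD addrACA -scalerBr.
  apply: (le_trans (rnorm_triangle _ _)); rewrite rnormZ mulrDr lerD//.
  by rewrite mulrCA ler_wpM2l// -ler0c RRe_real// normr_real.
have nZ x : rnorm (Z x) <= rnorm x.
  apply/ler_addgt0Pr => e e0.
  have [n ne] : exists n, n.+1%:R^-1 * (2 * rnorm x) < e.
    by exists (Num.truncn (2 * rnorm x / e)); exact: inv_mul_lt.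
  have := rnorm_triangle (Z x - Y n x) (Y n x); rewrite subrK => /le_trans; apply.
  by rewrite addrC lerD// (le_trans (ZP _ _))// ltW.
have cZ : contractive Z.
  by split=> //; apply/bounded_opP; split=> //; exists 1 => // x; rewrite mul1r.
exists Z; split=> //.
- apply: adj_unique => [|x y]; first by case: cZ.
  apply/eqP; rewrite -subr_eq0 -normr_eq0; apply/eqP.
  have nE (z : R[i]) : `|z| = (complex.Re `|z|)%:C by rewrite RRe_real// normr_real.
  rewrite nE -(rmorph0 (real_complex R)); congr (_%:C); apply/eqP.
  rewrite eq_le -[X in _ && X]ler0c -nE normr_ge0 andbT.
  apply/ler_addgt0Pr => e e0; rewrite add0r.
  pose c := 4 * (rnorm x * rnorm y).
  have [n ne] : exists n, n.+1%:R^-1 * c < e.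
    by exists (Num.truncn (c / e)); exact: inv_mul_lt.
  apply: le_trans (ltW ne); rewrite -lecR -nE.
  have -> : inner (Z x) y - inner x (Z y) = inner (Z x - Y n x) y - inner x (Z y - Y n y).
    rewrite innerBl innerBr -(newton_adj n) -adjE ?newton_adj; last exact: newton_bounded.
    by rewrite opprB addrA subrK.
  apply: (le_trans (ler_normB _ _)).
  apply: (le_trans (lerD (cauchy_schwarz _ _) (cauchy_schwarz _ _))).
  rewrite -rmorphD lecR /c; have := ZP n x; have := ZP n y.
  have := rnorm_ge0 x; have := rnorm_ge0 y.
  move: (rnorm (Z x - _)) (rnorm (Z y - _)) (rnorm x) (rnorm y) (n.+1%:R^-1).
  by move=> p q a b k; nra.
- move=> x; apply: (@approx_eq _ _ (6 * rnorm x + 2 * rnorm (Z x))) => n.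
  have -> : Z x + Z x - (B x + Z (Z x)) = (Z x - Y n.+1 x) + (Z x - Y n.+1 x) +
      (Y n (Y n x - Z x) + (Y n (Z x) - Z (Z x))).
    have YE : Y n.+1 x + Y n.+1 x = B x + Y n (Y n x).
      rewrite newtonS -scalerDl -rmorphD; have -> : 2^-1 + 2^-1 = 1 :> R by lra.
      by rewrite scale1r.
    rewrite (linB (lY n)) [X in _ = _ + X]addrA subrK [X in _ = X + _]addrACA -opprD YE.
    by rewrite -[RHS]addrA !opprD [X in _ = _ + X]addrA subrK.
  apply: (le_trans (rnorm_triangle _ _)).
  have h1 := le_trans (rnorm_triangle _ _) (lerD (ZP n.+1 x) (ZP n.+1 x)).
  have h2 : rnorm (Y n (Y n x - Z x) + (Y n (Z x) - Z (Z x))) <=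
      n.+1%:R^-1 * (2 * rnorm x) + n.+1%:R^-1 * (2 * rnorm (Z x)).
    apply: (le_trans (rnorm_triangle _ _)); apply: lerD => //.
    by apply: (le_trans (YP _ _)).
  have h3 : n.+2%:R^-1 <= n.+1%:R^-1 :> R.
    by rewrite lef_pV2 ?posrE ?ltr0n// ler_nat.
  apply: (le_trans (lerD h1 h2)); move: h3 (rnorm_ge0 x).
  move: (n.+2%:R^-1) (n.+1%:R^-1) (rnorm x) (rnorm (Z x)) => p q a b pq a0.
  by nra.
- move=> C bC CB; apply/funext => x /=.
  have CY n y : C (Y n y) = Y n (C y).
    elim: n y => [|n IH] y; first by rewrite [Y 0%N y]/(0 : H) lin0//; exact: bounded_lin.
    have lC := bounded_lin bC.
    by rewrite !newtonS linZ// linD// !IH -[C (B y)]/((C \o B) y) CB.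
  have /bounded_opP[lC [c c0 cC]] := bC.
  apply: (@approx_eq _ _ (c * (2 * rnorm x) + 2 * rnorm (C x))) => n.
  apply: (le_trans (rnorm_triangleB _ (C (Y n x)) _)).
  rewrite mulrDr lerD//; last by rewrite CY.
  rewrite -linB//; apply: (le_trans (cC _)).
  by rewrite mulrCA ler_wpM2l.
Qed.

End Newton.
End SquareRoot.

(** * Existence and uniqueness of square roots, absolute value, polar decomposition *)

Section AbsPolar.
Context {R : realType} {H : hilbertType R}.
Implicit Types (x y z : H) (A S T P C U : H -> H).

(** For k large, B = 1 - P / k is a positive contraction; with (1 - Z)^2 = 1 - B = P / k, the root
    is sqrt k (1 - Z). *)
Lemma sqrt_exists P : positive_op P -> exists S, [/\ positive_op S, S \o S = P &
  forall C, bounded_op C -> C \o P = P \o C -> C \o S = S \o C].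
Proof.
move=> pP; have [k k0 kP] := positive_scaled pP.
have ki0 : 0 <= k^-1 by rewrite invr_ge0 ltW.
have pK := positiveZ ki0 pP.
pose B := @id H - k^-1%:C *: P.
have BE x : B x = x - k^-1%:C *: P x by [].
have pB : positive_op B.
  apply/positive_opP; split.
  - by apply: boundedB; [exact: bounded_id|exact: positive_bounded].
  - by rewrite adjB ?adj_id ?positive_adj//; [exact: bounded_id|exact: positive_bounded].
  - by move=> x; rewrite BE rdotDl rdotNl subr_ge0 rdot_self.
have [|_ cB] := positive_contractive pB.
  move=> x; rewrite BE rdotDl rdotNl rdot_self gerDl oppr_le0.
  exact: (positive_rdot_ge0 x pK).
have [Z [cZ sZ ZE ZC]] := newton_limit cB (positive_adj pB).
have bZ := contractive_bounded cZ.
pose S := (Num.sqrt k)%:C *: (@id H - Z).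
have SE x : S x = (Num.sqrt k)%:C *: (x - Z x) by [].
exists S; split.
- apply: positiveZ; first exact: sqrtr_ge0.
  apply/positive_opP; split.
  + by apply: boundedB => //; exact: bounded_id.
  + by rewrite adjB ?adj_id ?sZ//; exact: bounded_id.
  + move=> x; rewrite [(_ - _) x]/(x - Z x) rdotDl rdotNl rdot_self subr_ge0.
    apply: (le_trans (cauchy_schwarz_rdot _ _)); rewrite expr2 ler_wpM2r ?rnorm_ge0//.
    by case: cZ.
- apply/funext => x /=; rewrite !SE (linZ (bounded_lin bZ)) (linB (bounded_lin bZ)).
  rewrite -scalerBr scalerA -rmorphM /= -expr2 sqr_sqrtr ?ltW//.
  rewrite -addrA -opprD [Z x + (Z x - _)]addrA ZE addrK BE subKr scalerA -rmorphM /=.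
  by rewrite divff ?scale1r// gt_eqF.
- move=> C bC CP; have lC := bounded_lin bC; apply/funext => x /=.
  rewrite !SE (linZ lC) (linB lC) -[C (Z x)]/((C \o Z) x) ZC//.
  by apply/funext => y /=; rewrite !BE (linB lC) (linZ lC) -[C (P y)]/((C \o P) y) CP.
Qed.

Lemma positive_square S : positive_op S -> positive_op (S \o S).
Proof.
move=> pS; have bS := positive_bounded pS; apply/positive_opP; split.
- exact: bounded_comp.
- by rewrite adj_comp// positive_adj.
- by move=> x /=; rewrite (positive_rdotC _ _ pS) rdot_self sqr_ge0.
Qed.

(* <(S + T) D x, D x> = 0 for D = S - T, since S and T commute. Hence
   S D x = T D x = 0, so that D D x = 0 and D = 0. *)
Lemma commuting_sqrt_unique S T : positive_op S -> positive_op T ->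
  S \o T = T \o S -> S \o S = T \o T -> S = T.
Proof.
move=> pS pT ST SS; apply/funext => x.
have lS := bounded_lin (positive_bounded pS); have lT := bounded_lin (positive_bounded pT).
pose d := S x - T x.
have h : S d + T d = 0.
  rewrite /d (linB lS) (linB lT) -[S (S x)]/((S \o S) x) SS -[S (T x)]/((S \o T) x) ST /=.
  by rewrite addrA subrK subrr.
have : rdot (S d) d + rdot (T d) d = 0 by rewrite -rdotDl h /rdot inner0l.
move=> /eqP; rewrite paddr_eq0 ?positive_rdot_ge0// => /andP[/eqP Sd /eqP Td].
have {}Sd := positive_rdot0 pS Sd; have {}Td := positive_rdot0 pT Td.
apply/eqP; rewrite -subr_eq0; apply/eqP/rnorm_sqr_le0.
rewrite -/d -rdot_self {1}/d rdotDl rdotNl (positive_rdotC _ _ pS) (positive_rdotC _ _ pT).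
by rewrite Sd Td subrr.
Qed.

(** The root Q produced by the iteration commutes with whatever commutes with S S = T T, so with
    both S and T; the commuting case applies to (Q, S) and to (Q, T). *)
Lemma sqrt_unique S T : positive_op S -> positive_op T -> S \o S = T \o T -> S = T.
Proof.
move=> pS pT ST; have [Q [pQ QE QC]] := sqrt_exists (positive_square pS).
have QS : Q = S by apply: commuting_sqrt_unique => //; rewrite QC//; exact: positive_bounded.
rewrite -QS; apply: commuting_sqrt_unique; rewrite ?QE// -?ST// QC//; last by rewrite ST.
exact: positive_bounded.
Qed.

Lemma opsqrtP P : positive_op P -> positive_op (opsqrt P) /\ opsqrt P \o opsqrt P = P.
Proof.
move=> /sqrt_exists[S [pS SP _]].
by apply: (@xgetPex _ (0 : H -> H) [set S | positive_op S /\ S \o S = P]); exists S.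
Qed.

Lemma opsqrt_unique P S : positive_op S -> S \o S = P -> opsqrt P = S.
Proof.
move=> pS SP; have [|h1 h2] := @opsqrtP P; first by rewrite -SP; exact: positive_square.
by apply: sqrt_unique => //; rewrite h2 SP.
Qed.

Lemma opsqrt_commute P C : positive_op P -> bounded_op C -> C \o P = P \o C ->
  C \o opsqrt P = opsqrt P \o C.
Proof.
move=> pP bC CP; have [S [pS SP SC]] := sqrt_exists pP.
by rewrite (opsqrt_unique pS SP) SC.
Qed.

Lemma positive_adj_comp T : bounded_op T -> positive_op (adjop T \o T).
Proof.
move=> bT; have bT' := bounded_adj bT; apply/positive_opP; split.
- exact: bounded_comp.
- by rewrite adj_comp// adjK.
- by move=> x /=; rewrite rdot_adj// adjK// rdot_self sqr_ge0.
Qed.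

Lemma positive_abs T : bounded_op T -> positive_op (opabs T).
Proof. by move=> /positive_adj_comp/opsqrtP[]. Qed.

Lemma bounded_abs T : bounded_op T -> bounded_op (opabs T).
Proof. by move=> /positive_abs/positive_bounded. Qed.

Lemma abs_sqr T : bounded_op T -> opabs T \o opabs T = adjop T \o T.
Proof. by move=> /positive_adj_comp/opsqrtP[]. Qed.

Lemma abs_unique T S : positive_op S -> S \o S = adjop T \o T -> opabs T = S.
Proof. exact: opsqrt_unique. Qed.

Lemma rnorm_abs T x : bounded_op T -> rnorm (opabs T x) = rnorm (T x).
Proof.
move=> bT; have pT := positive_abs bT.
suff h : rnorm (opabs T x) ^+ 2 = rnorm (T x) ^+ 2.
  by apply/eqP; rewrite -(@eqrXn2 _ 2) ?h ?rnorm_ge0.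
rewrite -!rdot_self positive_rdotC// -[opabs T (_ x)]/((opabs T \o opabs T) x) abs_sqr//.
by rewrite rdot_adj.
Qed.

Lemma ker_abs T : bounded_op T -> opker (opabs T) = opker T.
Proof.
move=> bT; apply/seteqP; split=> x /= Tx; apply: rnorm_eq0.
  by rewrite -rnorm_abs// Tx rnorm0.
by rewrite rnorm_abs// Tx rnorm0.
Qed.

Definition closed_range T : set H :=
  [set y | forall e : R, 0 < e -> exists x, rnorm (y - T x) < e].

Lemma closed_subspace_range T : linear T -> closed_subspace (closed_range T).
Proof.
move=> lT; split.
- apply/closed_rnormP => x h e e0; have e2 : 0 < e / 2 by rewrite divr_gt0.
  have [y /(_ _ e2)[z yz] xy] := h _ e2; exists z.
  by apply: (le_lt_trans (rnorm_triangleB _ y _)); rewrite [e]splitr ltrD.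
- by move=> e e0; exists 0; rewrite lin0// subr0 rnorm0.
- move=> a x y hx hy e e0.
  have a0 : 0 <= complex.Re `|a| by rewrite -ler0c RRe_real ?normr_real.
  have c0 : 0 < complex.Re `|a| + 1 by rewrite ltr_wpDl.
  have [|u xu] := hx (e / 2 / (complex.Re `|a| + 1)); first by rewrite !divr_gt0.
  have [|v yv] := hy (e / 2); first by rewrite divr_gt0.
  exists (a *: u + v); rewrite lT opprD addrACA -scalerBr.
  apply: (le_lt_trans (rnorm_triangle _ _)); rewrite [e]splitr ler_ltD//.
  rewrite rnormZ; move: xu; rewrite ltr_pdivlMr// => /ltW; apply: le_trans.
  by rewrite mulrC ler_wpM2l ?rnorm_ge0// lerDl.
Qed.

(** The residual of x off the closed range lies in the kernel of the self-adjoint S, so it is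
    orthogonal both to x and to the projection of x, hence to itself. *)
Lemma orth_ker_closed_range S x : bounded_op S -> adjop S = S ->
  orthocomp (opker S) x -> closed_range S x.
Proof.
move=> bS sS Kx; have cN := closed_subspace_range (bounded_lin bS).
have [NP xP] := orthprojP x cN; set p := orthproj _ x in NP xP.
have SN y : closed_range S (S y) by move=> e e0; exists y; rewrite subrr rnorm0.
have Kxp : opker S (x - p).
  apply: inner_ext => y; rewrite inner0l adjE// sS; exact: xP.
suff -> : x = p by [].
apply/eqP; rewrite -subr_eq0; apply/eqP/rnorm_sqr_le0.
by rewrite -rdot_self /rdot innerBr (xP p NP) subr0 innerC Kx// conjC0.
Qed.

Section Polar.
Variables (T : H -> H) (bT : bounded_op T).
Let X := opabs T.
Let K := opker T.
Let lT : linear T := bounded_lin bT.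
Let lX : linear X := bounded_lin (bounded_abs bT).
Let cK : closed_subspace K := closed_subspace_ker bT.
Let coP z : H := z - orthproj K z.

(** The closure of the set of pairs (|T| x, T x), read at the component of z orthogonal to the
    kernel of T. As a relation it can be handled before it is known to be a function. *)
Let polar_graph z w := forall e : R, 0 < e ->
  exists x, rnorm (X x - coP z) < e /\ rnorm (T x - w) < e.

Let coP_linear : linear coP.
Proof.
move=> a x y; rewrite /coP (bounded_lin (contractive_bounded (orthproj_contractive cK))).
by rewrite opprD addrACA scalerBr.
Qed.

Let rnormXT x y : rnorm (X x - X y) = rnorm (T x - T y).
Proof. by rewrite -(linB lX) -(linB lT) rnorm_abs. Qed.

Let polar_graph_linear a z1 w1 z2 w2 :
  polar_graph z1 w1 -> polar_graph z2 w2 -> polar_graph (a *: z1 + z2) (a *: w1 + w2).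
Proof.
move=> g1 g2 e e0.
have a0 : 0 <= complex.Re `|a| by rewrite -ler0c RRe_real ?normr_real.
have c0 : 0 < complex.Re `|a| + 1 by rewrite ltr_wpDl.
have [|x [x1 x2]] := g1 (e / 2 / (complex.Re `|a| + 1)); first by rewrite !divr_gt0.
have [|y [y1 y2]] := g2 (e / 2); first by rewrite divr_gt0.
have h u v : rnorm u < e / 2 / (complex.Re `|a| + 1) -> rnorm v < e / 2 -> rnorm (a *: u + v) < e.
  move=> ue ve; apply: (le_lt_trans (rnorm_triangle _ _)); rewrite [e]splitr ler_ltD//.
  rewrite rnormZ; move: ue; rewrite ltr_pdivlMr// => /ltW; apply: le_trans.
  by rewrite mulrC ler_wpM2l ?rnorm_ge0// lerDl.
have sumE (p q r s : H) : a *: p + q - (a *: r + s) = a *: (p - r) + (q - s).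
  by rewrite opprD addrACA -scalerBr.
by exists (a *: x + y); split; rewrite ?lX ?lT ?coP_linear sumE; apply: h.
Qed.

Let polar_graph_norm z w : polar_graph z w -> rnorm w = rnorm (coP z).
Proof.
move=> g; apply/eqP; rewrite -subr_eq0 -normr_le0; apply/ler_addgt0Pr => e e0; rewrite add0r.
have [|x [x1 x2]] := g (e / 2); first by rewrite divr_gt0.
have n1 : rnorm (T x) = rnorm (X x) by rewrite rnorm_abs.
have := rnorm_triangle (X x - coP z) (coP z); rewrite subrK.
have := rnorm_triangle (coP z - X x) (X x); rewrite subrK (rnormBC (coP z) (X x)).
have := rnorm_triangle (T x - w) w; rewrite subrK.
have := rnorm_triangle (w - T x) (T x); rewrite subrK (rnormBC w (T x)).
by move=> *; rewrite ler_norml; lra.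
Qed.

Let polar_graph_exists z : exists w, polar_graph z w.
Proof.
have coPX : closed_range X (coP z).
  apply: orth_ker_closed_range; [exact: bounded_abs|exact/positive_adj/positive_abs|].
  by rewrite ker_abs//; have [] := orthprojP z cK.
have n0 n : 0 < n.+1%:R^-1 :> R by rewrite invr_gt0 ltr0n.
have /choice[u uP] : forall n, exists x, rnorm (coP z - X x) < n.+1%:R^-1.
  by move=> n; apply: coPX.
have inv_small (e : R) n : 0 < e -> (Num.truncn (1 / e) <= n)%N -> n.+1%:R^-1 < e.
  by move=> e0 /(inv_mul_lt e0); rewrite mulr1.
have [w wP] : exists w, tends (T \o u) w.
  apply: cauchy_tends => e e0; have e2 : 0 < e / 2 by rewrite divr_gt0.
  exists (Num.truncn (1 / (e / 2))) => m n Nm Nn /=; rewrite -rnormXT.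
  apply: (le_lt_trans (rnorm_triangleB _ (coP z) _)); rewrite [e]splitr ltrD//.
    by rewrite rnormBC (lt_trans (uP m))// inv_small.
  by rewrite (lt_trans (uP n))// inv_small.
exists w => e e0; have [N NP] := wP e e0; pose n := maxn N (Num.truncn (1 / e)).
exists (u n); split; last by apply: NP; rewrite leq_maxl.
by rewrite rnormBC (lt_trans (uP n))// inv_small// leq_maxr.
Qed.

(* Since | |T| x | = |T x|, the map |T| x |-> T x extends by continuity. *)
Lemma polar_exists : exists U, [/\ partial_isometry U, T = U \o opabs T & opker U = opker T].
Proof.
have /choice[U UP] := polar_graph_exists.
(* The difference of two values at z is a value at 0, whose norm is 0 by [polar_graph_norm]. *)
have uniq z w w' : polar_graph z w -> polar_graph z w' -> w = w'.
  move=> g g'; apply/eqP; rewrite -subr_eq0; apply/eqP/rnorm_eq0.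
  rewrite -scaleN1r addrC (polar_graph_norm (polar_graph_linear (-1) g' g)).
  by rewrite scaleN1r addNr /coP orthproj_id ?subrr ?rnorm0//; case: cK.
have lU : linear U.
  by move=> a x y; apply: (uniq (a *: x + y)) => //; apply: polar_graph_linear.
have nU z : rnorm (U z) = rnorm (coP z) by exact: polar_graph_norm.
have bU : bounded_op U.
  apply/bounded_opP; split=> //; exists 1 => // x; rewrite nU mul1r.
  apply: rnorm_mono; first exact: rnorm_ge0.
  by rewrite -(orthproj_pythagoras cK x) lerDr sqr_ge0.
have kU : opker U = K.
  apply/seteqP; split=> z /= hz.
    have : rnorm (coP z) = 0 by rewrite -nU hz rnorm0.
    by move/rnorm_eq0/eqP; rewrite subr_eq0 => /eqP ->; apply: orthproj_mem.
  by apply: rnorm_eq0; rewrite nU /coP orthproj_id// subrr rnorm0.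
exists U; split=> //.
- split=> // x; rewrite kU => Kx; rewrite !rnormE nU /coP orthproj_orth// ?subr0//.
- apply/funext => x /=; apply: (uniq (X x)) => // e e0; exists x.
  rewrite subrr rnorm0 /coP orthproj_orth ?subr0 ?subrr ?rnorm0// => y Ky.
  rewrite /X -[opabs T]positive_adj; last exact: positive_abs.
  by rewrite adjEr; [move: Ky; rewrite /K -ker_abs//= => ->; rewrite inner0r|exact: bounded_abs].
Qed.

End Polar.

Lemma polarP T (U := polarop T) : bounded_op T ->
  [/\ partial_isometry U, T = U \o opabs T & opker U = opker T].
Proof.
move=> /polar_exists[U' hU]; apply: (@xgetPex _ (0 : H -> H)
  [set U | [/\ partial_isometry U, T = U \o opabs T & opker U = opker T]]).
by exists U'.
Qed.

Lemma polar_contractive T : bounded_op T -> contractive (polarop T).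
Proof. by move=> /polarP[/partial_isometry_contractive]. Qed.

(** The polar part U is isometric on the range of |T|, so U^* U fixes that range. *)
Lemma polar_adj_comp T : bounded_op T -> adjop (polarop T) \o T = opabs T.
Proof.
move=> bT; have [_ TE _] := polarP bT; apply/funext => x /=; rewrite {2}TE /=.
apply: contractive_isometric; first exact: polar_contractive.
by rewrite rnorm_abs// [in RHS]TE.
Qed.

End AbsPolar.

(** * Orthonormal bases and Hilbert-Schmidt operators *)

Section OrthonormalBasis.
Context {R : realType} {H : hilbertType R}.
Implicit Types (x y z : H).

Section GramSchmidt.
Variable d : nat -> H.

(** Zero is kept: a vector of [d] that depends on its predecessors yields a zero Gram-Schmidt
    vector, whose index is dropped in [onb_exists]. *)
Definition normalize x : H := if x == 0 then 0 else (rnorm x)^-1%:C *: x.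

(** The projection onto the first n Gram-Schmidt vectors. These are recomputed inside the recursion,
    since [gs] is itself defined from this projection. *)
Fixpoint gs_proj n x : H :=
  if n is m.+1 then
    let e := normalize (d m - gs_proj m (d m)) in gs_proj m x + inner x e *: e
  else 0.

Definition gs n : H := normalize (d n - gs_proj n (d n)).

Lemma normalizeE x : x = (rnorm x)%:C *: normalize x.
Proof.
rewrite /normalize; case: eqVneq => [->|x0]; first by rewrite scaler0.
rewrite scalerA -rmorphM /= divff ?scale1r//.
by apply: contraNneq x0 => /rnorm_eq0 ->.
Qed.

Lemma normalize_unit x : normalize x != 0 -> inner (normalize x) (normalize x) = 1.
Proof.
rewrite /normalize; case: (eqVneq x 0) => [_ /eqP|x0 _] //.
have nx : rnorm x != 0 by apply: contraNneq x0 => /rnorm_eq0 ->.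
rewrite inner_self rnormZR ger0_norm ?invr_ge0 ?rnorm_ge0//.
by rewrite mulVf// expr1n.
Qed.

Lemma gs_projS n x : gs_proj n.+1 x = gs_proj n x + inner x (gs n) *: gs n.
Proof. by []. Qed.

Lemma gs_proj_orth n x y : (forall i, (i < n)%N -> inner (gs i) y = 0) ->
  inner (gs_proj n x) y = 0.
Proof.
elim: n => [|n IH] h; first exact: inner0l.
rewrite gs_projS innerDl innerZl h// mulr0 addr0 IH// => i ni.
by apply: h; rewrite ltnS ltnW.
Qed.

Lemma gs_orth_resid n x i : (i < n)%N -> inner (x - gs_proj n x) (gs i) = 0.
Proof.
elim: n x i => [//|n IH] x i.
have on j : (j < n)%N -> inner (gs n) (gs j) = 0.
  move=> jn; have := IH (d n) _ jn; rewrite [d n - _]normalizeE innerZl -/(gs n).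
  move=> /eqP; rewrite mulf_eq0 => /orP[|/eqP//].
  rewrite -(rmorph0 (real_complex R)) => /eqP/complexI/rnorm_eq0.
  by rewrite /gs => ->; rewrite /normalize eqxx inner0l.
rewrite ltnS leq_eqVlt gs_projS => /predU1P[->{i}|i_n].
  rewrite opprD addrA innerBl innerBl innerZl gs_proj_orth ?subr0 => [|i i_n]; last first.
    by rewrite innerC on// conjC0.
  have [->|/normalize_unit ->] := eqVneq (gs n) 0; first by rewrite !inner0r mulr0 subrr.
  by rewrite mulr1 subrr.
by rewrite opprD addrA innerBl IH// innerZl on// mulr0 subr0.
Qed.

Lemma gs_orth i j : i != j -> inner (gs i) (gs j) = 0.
Proof.
have h k l : (k < l)%N -> inner (gs l) (gs k) = 0.
  move=> kl; have := gs_orth_resid (d l) kl; rewrite [d l - _]normalizeE innerZl -/(gs l).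
  move=> /eqP; rewrite mulf_eq0 => /orP[|/eqP//].
  rewrite -(rmorph0 (real_complex R)) => /eqP/complexI/rnorm_eq0.
  by rewrite /gs => ->; rewrite /normalize eqxx inner0l.
by rewrite neq_ltn => /orP[/h ij|/h//]; rewrite innerC ij conjC0.
Qed.

Lemma gs_total x : (forall i, inner x (gs i) = 0) -> forall n, inner (d n) x = 0.
Proof.
move=> h n; rewrite -[d n](subrK (gs_proj n (d n))) innerDl.
rewrite (gs_proj_orth (d n)) => [|i _]; last by rewrite innerC h conjC0.
by rewrite [X in inner X _]normalizeE innerZl innerC h conjC0 mulr0 addr0.
Qed.

End GramSchmidt.

(** Gram-Schmidt on a dense sequence d. A vector x orthogonal to the result is orthogonal to every d
    n, so |x|^2 = Re <x, x - d n>, and d n can be taken close to x. *)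
Lemma onb_exists : separable_space H -> exists (I : set nat) (e : nat -> H), is_onb I e.
Proof.
move=> [D cD dD].
have [d dP] : exists d : nat -> H, forall x, D x -> exists n, d n = x.
  have /countable_injP[f fI] := cD.
  exists (fun n => xget 0 [set x | D x /\ f x = n]) => x Dx; exists (f x).
  have [Dy fy] := @xgetPex _ (0 : H) [set y | D y /\ f y = f x] (ex_intro _ x (conj Dx erefl)).
  by apply: fI; rewrite ?inE.
exists [set n | gs d n != 0], (gs d); split=> [i j /= i0 j0|x h].
  have [<-|ij] := eqVneq i j; first exact: normalize_unit.
  exact: gs_orth.
have {}h n : inner x (gs d n) = 0.
  by have [->|/h//] := eqVneq (gs d n) 0; rewrite inner0r.
apply/rnorm_eq0/eqP; rewrite eq_le rnorm_ge0 andbT; apply/ler_addgt0Pr => e e0; rewrite add0r.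
have [y [/= xy /dP[n ny]]] : exists y, rnorm (x - y) < e /\ D y.
  have [|y [By Dy]] := dD (interior [set y | rnorm (x - y) < e]) _ (@open_interior _ _).
    by exists x; apply/nbhs_rnormP; exists e.
  by exists y; split=> //; exact: interior_subset By.
have xd : inner x (d n) = 0 by rewrite innerC (gs_total h) conjC0.
have [->|nx] := eqVneq (rnorm x) 0; first exact: ltW.
have n0 : 0 < rnorm x by rewrite lt_neqAle eq_sym nx rnorm_ge0.
rewrite -(ler_pM2l n0) -expr2 -rdot_self.
have -> : rdot x x = rdot x (x - y) by rewrite rdotDr rdotNr -ny /rdot xd oppr0 addr0.
apply: (le_trans (cauchy_schwarz_rdot _ _)); rewrite ler_wpM2l ?rnorm_ge0//.
exact: ltW.
Qed.

End OrthonormalBasis.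

(** * Fourier expansion and Parseval's identity *)

Section Parseval.
Context {R : realType} {H : hilbertType R} (sepH : separable_space H).
Implicit Types (x y z : H) (T : H -> H).

(* The basis onb, padded with zero vectors at the indices outside onb.1. *)
Definition bas i : H := if i \in (@onb R H).1 then (@onb R H).2 i else 0.

Lemma onbP : is_onb (@onb R H).1 (@onb R H).2.
Proof.
have [I [e Ie]] := onb_exists sepH.
by apply: (@xgetPex _ (set0, fun=> 0) [set b : set nat * (nat -> H) | is_onb b.1 b.2]); exists (I, e).
Qed.

Lemma bas_orth i j : i != j -> inner (bas i) (bas j) = 0.
Proof.
move=> ij; rewrite /bas; case: ifP => [iI|]; last by rewrite inner0l.
case: ifP => [jI|]; last by rewrite inner0r.
by rewrite onbP.1 ?(negbTE ij)//; exact: set_mem.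
Qed.

Lemma bas_unit i : bas i = 0 \/ inner (bas i) (bas i) = 1.
Proof.
rewrite /bas; case: ifP => iI; [right|by left].
by rewrite onbP.1 ?eqxx//; exact: set_mem.
Qed.

Lemma bas_total x : (forall i, inner x (bas i) = 0) -> x = 0.
Proof. by move=> h; apply: onbP.2 => i Ii; have := h i; rewrite /bas mem_set. Qed.

Definition nsq (z : R[i]) : R := complex.Re z ^+ 2 + complex.Im z ^+ 2.

Lemma nsq_ge0 (w : R[i]) : 0 <= nsq w.
Proof. by rewrite addr_ge0 ?sqr_ge0. Qed.

Lemma nsqE (w : R[i]) : (nsq w)%:C = w * w^*%R.
Proof. by rewrite -normCK -add_Re2_Im2. Qed.

Lemma nsq_conj (w : R[i]) : nsq w^*%R = nsq w.
Proof. by case: w => a b; rewrite /nsq /= sqrrN. Qed.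

Definition partial n x : H := \sum_(i < n) inner x (bas i) *: bas i.

Lemma partialS n x : partial n.+1 x = partial n x + inner x (bas n) *: bas n.
Proof. by rewrite /partial big_ord_recr. Qed.

Lemma partial_orth n x j : (n <= j)%N -> inner (partial n x) (bas j) = 0.
Proof.
move=> nj; rewrite inner_suml big1// => i _.
by rewrite innerZl bas_orth ?mulr0// ltn_eqF// (leq_trans (ltn_ord i)).
Qed.

Lemma partial_coef n x j : (j < n)%N -> inner (partial n x) (bas j) = inner x (bas j).
Proof.
move=> jn; rewrite inner_suml (bigD1 (Ordinal jn))//= big1 => [|i ij].
  rewrite innerZl addr0; have [->|->] := bas_unit j; first by rewrite !inner0r mulr0.
  by rewrite mulr1.
by rewrite innerZl bas_orth ?mulr0.
Qed.

Lemma partial_norm m n x : (n <= m)%N ->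
  rnorm (partial m x - partial n x) ^+ 2 = \sum_(n <= i < m) nsq (inner x (bas i)).
Proof.
move=> /subnKC <-; elim: (m - n)%N => [|k IH].
  by rewrite addn0 subrr rnorm0 expr0n big_geq.
rewrite addnS big_nat_recr ?leq_addr//= -IH partialS addrAC [LHS]rnormD_sqr.
have -> : rdot (partial (n + k) x - partial n x) (inner x (bas (n + k)) *: bas (n + k)) = 0.
  by rewrite /rdot innerZr innerBl !partial_orth ?leq_addr// subr0 mulr0.
rewrite mulr0 addr0; congr (_ + _); apply: complexI.
rewrite -inner_self innerZl innerZr nsqE.
have [->|->] := bas_unit (n + k); first by rewrite !inner0r !mul0r.
by rewrite mulr1.
Qed.

Lemma bessel n x :
  rnorm (x - partial n x) ^+ 2 = rnorm x ^+ 2 - \sum_(0 <= i < n) nsq (inner x (bas i)).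
Proof.
have := partial_norm x (leq0n n); rewrite [partial 0%N x]big_ord0 subr0 => <-.
have h : rnorm x ^+ 2 = rnorm (x - partial n x + partial n x) ^+ 2 by rewrite subrK.
rewrite h [in RHS]rnormD_sqr.
have -> : rdot (x - partial n x) (partial n x) = 0; last by rewrite mulr0 addr0 addrK.
rewrite /rdot innerC [X in inner X _]/partial inner_suml big1 ?conjC0// => i _.
by rewrite innerZl (innerC (_ - _)) innerBl partial_coef// subrr conjC0 mulr0.
Qed.

(** Bessel bounds the sums of squared coefficients, so the partial sums are Cauchy. Their limit has
    the coefficients of x, and totality of the basis identifies the two. *)
Lemma partial_tends x : tends (partial^~ x) x.
Proof.
pose s n := \sum_(0 <= i < n) nsq (inner x (bas i)).
have sn : nondecreasing_seq s.
  apply/nondecreasing_seqP => n; rewrite /s big_nat_recr//= lerDl; exact: nsq_ge0.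
have sb n : s n <= rnorm x ^+ 2.
  by rewrite -subr_ge0 -bessel sqr_ge0.
have cs : cvgn s by apply: nondecreasing_is_cvgn => //; exists (rnorm x ^+ 2) => _ [n _ <-].
have [l lP] : exists l, tends (partial^~ x) l.
  apply: cauchy_tends => e e0; have e2 : 0 < e ^+ 2 by rewrite exprn_gt0.
  have /cvgrPdist_lt/(_ _ e2)[N _ NP] := cs.
  exists N => m n Nm Nn; rewrite -(@ltr_pXn2r _ 2)// ?nnegrE ?rnorm_ge0 ?ltW//.
  wlog nm : m n Nm Nn / (n <= m)%N.
    move=> h; have [|/ltnW] := leqP n m; first exact: h.
    by rewrite rnormBC; exact: h.
  rewrite partial_norm//; have := NP n Nn; have := nondecreasing_cvgn_le sn cs m.
  have -> : \sum_(n <= i < m) nsq (inner x (bas i)) = s m - s n.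
    by rewrite /s (@big_cat_nat _ _ _ n 0 m)//= addrAC subrr add0r.
  by move=> h /=; rewrite ltr_norml => /andP[_]; lra.
suff xl : x - l = 0 by move/eqP: xl; rewrite subr_eq0 => /eqP xl; move: lP; rewrite -xl.
apply: bas_total => j.
apply/eqP; rewrite -normr_le0.
have nE (z : R[i]) : `|z| = (complex.Re `|z|)%:C by rewrite RRe_real// normr_real.
rewrite nE lecR; apply/ler_addgt0Pr => e e0; rewrite add0r -lecR -nE.
have b1 : rnorm (bas j) <= 1.
  apply: rnorm_mono => //; rewrite -rdot_self /rdot expr1n.
  by have [->|->] := bas_unit j; rewrite ?inner0l//= ler01.
have [N NP] := lP e e0; pose n := maxn N j.+1.
have -> : inner (x - l) (bas j) = inner (partial n x - l) (bas j).
  by rewrite !innerBl partial_coef// leq_maxr.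
apply: (le_trans (cauchy_schwarz _ _)); rewrite lecR.
apply: (@le_trans _ _ (rnorm (partial n x - l) * 1)); first by rewrite ler_wpM2l ?rnorm_ge0.
by rewrite mulr1 ltW// NP// leq_maxl.
Qed.

Lemma parseval x : (\sum_(0 <= i <oo) (nsq (inner x (bas i)))%:E)%E = (rnorm x ^+ 2)%:E.
Proof.
apply/cvg_lim => //.
have -> : (fun n => (\sum_(0 <= i < n) (nsq (inner x (bas i)))%:E)%E) =
    (fun n => (rnorm x ^+ 2 - rnorm (x - partial n x) ^+ 2)%:E).
  by apply/funext => n; rewrite sumEFin bessel subKr.
apply: cvg_EFin; first by near=> n.
rewrite -[X in _ --> X]subr0; apply: cvgB; first exact: cvg_cst.
have h : (fun n => rnorm (x - partial n x)) @ \oo --> (0 : R).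
  apply/cvgrPdist_lt => e e0; have [N NP] := partial_tends x e0.
  exists N => // n Nn; rewrite sub0r normrN ger0_norm ?rnorm_ge0//.
  by rewrite rnormBC; apply: NP.
have -> : (fun n => rnorm (x - partial n x) ^+ 2) =
  (fun n => rnorm (x - partial n x)) \* (fun n => rnorm (x - partial n x)) by [].
rewrite -[X in _ --> X](mulr0 (0 : R)); apply: cvgM; exact: h.
Unshelve. all: by end_near.
Qed.

End Parseval.

(** * Hilbert-Schmidt operators and convergent traces *)

Section HilbertSchmidt.
Context {R : realType} {H : hilbertType R} (sepH : separable_space H).
Implicit Types (x y z : H) (S T X Y F : H -> H).

(** The square of the Hilbert-Schmidt norm, in the extended reals so that nonnegative series can be
    rearranged before finiteness is known. *)
Definition hs T : \bar R := (\sum_(0 <= i <oo) (rnorm (T (bas i)) ^+ 2)%:E)%E.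

Definition hilbert_schmidt T : Prop := bounded_op T /\ (hs T < +oo)%E.

Lemma hs_ge0 T : (0 <= hs T)%E.
Proof. by apply: nneseries_ge0 => i _ _; rewrite lee_fin sqr_ge0. Qed.

(** By Parseval both sides are the double series of the |<T e_i, e_j>|^2; this is the only
    interchange of sums. *)
Lemma hs_adj T : bounded_op T -> hs (adjop T) = hs T.
Proof.
move=> bT; rewrite /hs.
under eq_eseriesr do rewrite -(parseval sepH).
rewrite nneseries_interchange => [|i j]; last by rewrite lee_fin nsq_ge0.
apply: eq_eseriesr => j _; rewrite -(parseval sepH); apply: eq_eseriesr => i _.
by rewrite adjEr// innerC nsq_conj.
Qed.

Lemma hs_le (c : R) S T : 0 <= c ->
  (forall i, rnorm (S (bas i)) <= c * rnorm (T (bas i))) -> (hs S <= (c ^+ 2)%:E * hs T)%E.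
Proof.
move=> c0 h; rewrite /hs -nneseriesZl; last by move=> i _; rewrite lee_fin sqr_ge0.
apply: lee_nneseries => [i _ _|i _]; first by rewrite lee_fin sqr_ge0.
by rewrite -EFinM lee_fin -exprMn ler_pXn2r ?nnegrE ?mulr_ge0 ?rnorm_ge0.
Qed.

Lemma hs_eq S T : (forall i, rnorm (S (bas i)) = rnorm (T (bas i))) -> hs S = hs T.
Proof. by move=> h; apply: eq_eseriesr => i _; rewrite h. Qed.

Lemma hs_adj_eq T S : hilbert_schmidt T -> S = adjop T -> hilbert_schmidt S.
Proof. by move=> [bT hT] ->; split; [exact: bounded_adj|rewrite hs_adj]. Qed.

Lemma hilbert_schmidt_adj T : hilbert_schmidt T -> hilbert_schmidt (adjop T).
Proof. by move=> hT; exact: hs_adj_eq hT _. Qed.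

Lemma hilbert_schmidt_compl F T : bounded_op F -> hilbert_schmidt T -> hilbert_schmidt (F \o T).
Proof.
move=> bF [bT hT]; split; first exact: bounded_comp.
have /bounded_opP[_ [c c0 cF]] := bF.
apply: le_lt_trans (@hs_le c _ T c0 _) _ => [i|]; first exact: cF.
by rewrite lte_mul_pinfty ?lee_fin ?sqr_ge0.
Qed.

Lemma hilbert_schmidt_compr F T : bounded_op F -> hilbert_schmidt T -> hilbert_schmidt (T \o F).
Proof.
move=> bF hT; have [bT _] := hT; have bF' := bounded_adj bF.
apply: (@hs_adj_eq (adjop F \o adjop T)).
  by apply: hilbert_schmidt_compl => //; exact: hilbert_schmidt_adj.
by rewrite adj_comp ?adjK//; exact: bounded_adj.
Qed.

Lemma hilbert_schmidtZ (a : R[i]) T : hilbert_schmidt T -> hilbert_schmidt (a *: T).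
Proof.
move=> hT; have -> : a *: T = (a *: @id H) \o T by [].
by apply: hilbert_schmidt_compl => //; apply: boundedZ; exact: bounded_id.
Qed.

Lemma hilbert_schmidtD S T : hilbert_schmidt S -> hilbert_schmidt T -> hilbert_schmidt (S + T).
Proof.
move=> [bS hS] [bT hT]; split; first exact: boundedD.
apply: (@le_lt_trans _ _ (2%:E * hs S + 2%:E * hs T)%E).
  rewrite /hs -!nneseriesZl; try by move=> i _; rewrite lee_fin sqr_ge0.
  rewrite -nneseriesD; try by move=> i _ _; rewrite mule_ge0 ?lee_fin ?sqr_ge0.
  apply: lee_nneseries => [i _ _|i _]; first by rewrite lee_fin sqr_ge0.
  rewrite -!EFinM -EFinD lee_fin -parallelogram lerDl; exact: sqr_ge0.
by rewrite lte_add_pinfty// lte_mul_pinfty.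
Qed.

Definition sqsum T n : R := \sum_(0 <= i < n) rnorm (T (bas i)) ^+ 2.

Lemma sqsum_cvg T : hilbert_schmidt T -> sqsum T @ \oo --> fine (hs T).
Proof.
move=> [bT hT].
have hf : hs T \is a fin_num by rewrite ge0_fin_numE ?hs_ge0.
have : (fun n => (\sum_(0 <= i < n) (rnorm (T (bas i)) ^+ 2)%:E)%E) @ \oo --> (fine (hs T))%:E.
  by rewrite fineK//; apply: is_cvg_nneseries => i _ _; rewrite lee_fin sqr_ge0.
move=> /fine_cvgP[_]; apply: cvg_trans; apply: near_eq_cvg; near=> n.
by rewrite /= sumEFin.
Unshelve. all: by end_near. Qed.

(** Complex limits by real and imaginary parts, to reuse the limit rules of R; [ctends_lim] returns
    to the limit that defines [optr]. *)
Definition ctends (u : nat -> R[i]) (l : R[i]) : Prop :=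
  (fun n => complex.Re (u n)) @ \oo --> complex.Re l /\
  (fun n => complex.Im (u n)) @ \oo --> complex.Im l.

Lemma ctends_lim u l : ctends u l -> limn (u : nat -> R[i]^o) = l.
Proof.
move=> [ur ui]; apply/cvg_lim => //; apply/(@cvgrPdist_lt _ R[i]^o) => e /Re_gt0[e0 eE].
have e2 : 0 < complex.Re e / 2 by rewrite divr_gt0.
have /cvgrPdist_lt/(_ _ e2) h1 := ur; have /cvgrPdist_lt/(_ _ e2) h2 := ui.
near=> n; rewrite eE.
have [k1 k2] : `|complex.Re l - complex.Re (u n)| < complex.Re e / 2 /\
   `|complex.Im l - complex.Im (u n)| < complex.Re e / 2 by split; near: n.
rewrite [l - u n]complexE; apply: le_lt_trans (ler_normD _ _) _.
rewrite normrM; have -> : `|'i%C : R[i]| = 1.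
  by rewrite normc_def /= expr0n add0r expr1n sqrtr1.
rewrite mul1r !normc_def /= expr0n /= !addr0 !sqrtr_sqr -rmorphD ltcR [X in _ < X]splitr.
case: (l) (u n) k1 k2 => [a b] [c d] /= k1 k2; exact: ltrD.
Unshelve. all: by end_near. Qed.

Lemma ctendsD u v k l : ctends u k -> ctends v l -> ctends (fun n => u n + v n) (k + l).
Proof.
move=> [u1 u2] [v1 v2]; split.
  have -> : complex.Re (k + l) = complex.Re k + complex.Re l by case: (k) (l) => ? ? [].
  have -> : (fun n => complex.Re (u n + v n)) = (fun n => complex.Re (u n) + complex.Re (v n)).
    by apply/funext => n; case: (u n) (v n) => ? ? [].
  exact: cvgD.
have -> : complex.Im (k + l) = complex.Im k + complex.Im l by case: (k) (l) => ? ? [].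
have -> : (fun n => complex.Im (u n + v n)) = (fun n => complex.Im (u n) + complex.Im (v n)).
  by apply/funext => n; case: (u n) (v n) => ? ? [].
exact: cvgD.
Qed.

Lemma ctendsZ (a : R[i]) u l : ctends u l -> ctends (fun n => a * u n) (a * l).
Proof.
case: a => a b [u1 u2].
have reE (w : R[i]) : complex.Re ((a +i* b) * w) = a * complex.Re w - b * complex.Im w by case: w.
have imE (w : R[i]) : complex.Im ((a +i* b) * w) = a * complex.Im w + b * complex.Re w.
  by case: w.
split.
  rewrite reE; under eq_fun do rewrite reE.
  by apply: cvgB; apply: cvgMr.
rewrite imE; under eq_fun do rewrite imE.
by apply: cvgD; apply: cvgMr.
Qed.

Lemma ctends_conj u l : ctends u l -> ctends (fun n => (u n)^*%R) l^*%R.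
Proof.
move=> [u1 u2]; split.
  have reE (w : R[i]) : complex.Re w^*%R = complex.Re w by case: w.
  by rewrite reE; under eq_fun do rewrite reE.
have imE (w : R[i]) : complex.Im w^*%R = - complex.Im w by case: w.
by rewrite imE; under eq_fun do rewrite imE; exact: cvgN.
Qed.

Lemma ctends_real (u : nat -> R) (l : R) : u @ \oo --> l -> ctends (fun n => (u n)%:C) l%:C.
Proof. by move=> ul; split => //=; exact: cvg_cst. Qed.

(** Relational form of [optr]: unlike a [limn], it carries convergence, as additivity requires. *)
Definition has_trace T (t : R[i]) : Prop :=
  ctends (fun n => \sum_(0 <= i < n) inner (T (bas i)) (bas i)) t.

Lemma optr_has_trace T t : has_trace T t -> optr T = t.
Proof.
move=> h; apply: ctends_lim; suff <- : (fun n => \sum_(0 <= i < n) inner (T (bas i)) (bas i)) =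
  (fun n => \sum_(0 <= i < n | i \in (@onb R H).1) inner (T ((@onb R H).2 i)) ((@onb R H).2 i)) by [].
apply/funext => n; rewrite [RHS]big_mkcond /=; apply: eq_bigr => i _.
by rewrite /bas; case: ifP => // _; rewrite inner0r.
Qed.

Lemma has_traceD S T s t : has_trace S s -> has_trace T t -> has_trace (S + T) (s + t).
Proof.
move=> hS hT; have := ctendsD hS hT; rewrite /has_trace.
under eq_fun do rewrite -big_split /=.
by under [X in _ -> ctends X _]eq_fun do under eq_bigr do rewrite fctE innerDl.
Qed.

Lemma has_traceZ (a : R[i]) T t : has_trace T t -> has_trace (a *: T) (a * t).
Proof.
move=> /(ctendsZ a); rewrite /has_trace; under eq_fun do rewrite mulr_sumr.
by under [X in _ -> ctends X _]eq_fun do under eq_bigr do rewrite fctE innerZl.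
Qed.

Lemma has_trace_adj T t : bounded_op T -> has_trace T t -> has_trace (adjop T) t^*%R.
Proof.
move=> bT /ctends_conj; rewrite /has_trace; under eq_fun do rewrite rmorph_sum /=.
by under [X in _ -> ctends X _]eq_fun do under eq_bigr do rewrite adjEr// innerC.
Qed.

(* Polarization: with it, the trace of a product of Hilbert-Schmidt operators
   and its cyclicity reduce to hs_adj, with no double series to swap. *)
Definition hs_form X Y : R[i] :=
  (4^-1 : R)%:C * ((fine (hs (X + Y)))%:C - (fine (hs (X - Y)))%:C
   + 'i%C * ((fine (hs (X + 'i%C *: Y)))%:C - (fine (hs (X - 'i%C *: Y)))%:C)).

Lemma polarization x y :
  inner x y = (4^-1 : R)%:C * ((rnorm (x + y) ^+ 2)%:C - (rnorm (x - y) ^+ 2)%:C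
   + 'i%C * ((rnorm (x + 'i%C *: y) ^+ 2)%:C - (rnorm (x - 'i%C *: y) ^+ 2)%:C)).
Proof.
rewrite -!inner_self !innerE.
have iJ : ('i%C : R[i])^*%R = - 'i%C by apply/eqP; rewrite eq_complex /= oppr0 !eqxx.
have i2 : ('i%C : R[i]) * 'i%C = -1 by rewrite -expr2 sqr_i.
rewrite iJ; move: ('i%C : R[i]) i2 => i i2.
have -> : (4^-1 : R)%:C = 4%:R^-1 :> R[i] by rewrite fmorphV rmorph_nat.
set p := inner x y; set q := inner y x; set a := inner x x; set b := inner y y.
transitivity (4%:R^-1 * (2%:R * (p + q) + i * i * (2%:R * (q - p)))).
  by rewrite i2; field.
congr (_ * _); ring.
Qed.

Lemma has_trace_form X Y : hilbert_schmidt X -> hilbert_schmidt Y ->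
  has_trace (adjop Y \o X) (hs_form X Y).
Proof.
move=> hX hY; have [bY _] := hY.
have hiY := hilbert_schmidtZ 'i%C hY.
have hN T : hilbert_schmidt T -> hilbert_schmidt (- T).
  by move=> /(hilbert_schmidtZ (-1)); rewrite scaleN1r.
have c1 := ctends_real (sqsum_cvg (hilbert_schmidtD hX hY)).
have c2 := ctends_real (sqsum_cvg (hilbert_schmidtD hX (hN _ hY))).
have c3 := ctends_real (sqsum_cvg (hilbert_schmidtD hX hiY)).
have c4 := ctends_real (sqsum_cvg (hilbert_schmidtD hX (hN _ hiY))).
have := ctendsZ (4^-1 : R)%:C (ctendsD (ctendsD c1 (ctendsZ (-1) c2))
  (ctendsZ 'i%C (ctendsD c3 (ctendsZ (-1) c4)))).
rewrite !mulN1r -/(hs_form X Y) /has_trace; congr ctends; apply/funext => n.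
rewrite !mulN1r /sqsum !rmorph_sum /= -!sumrB mulr_sumr -big_split mulr_sumr /=.
by apply: eq_bigr => i _; rewrite adjEr// polarization.
Qed.

(** For |a| = 1, the squared norm of X^* + a Y^* is that of X + conj(a) Y, hence that of a X + Y;
    the four terms of the polarization match one by one. *)
Lemma hs_form_cyclic X Y : bounded_op X -> bounded_op Y ->
  hs_form (adjop X) (adjop Y) = hs_form Y X.
Proof.
move=> bX bY; rewrite /hs_form.
have h (a : R[i]) : `|a| = 1 -> hs (adjop X + a *: adjop Y) = hs (Y + a *: X).
  move=> a1; have baY : bounded_op (a^*%R *: Y) by exact: boundedZ.
  have -> : adjop X + a *: adjop Y = adjop (X + a^*%R *: Y) by rewrite adjD// adjZ// conjCK.
  rewrite hs_adj; last exact: boundedD.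
  apply: hs_eq => i; rewrite !fctE.
  have -> : Y (bas i) + a *: X (bas i) = a *: (X (bas i) + a^*%R *: Y (bas i)).
    by rewrite scalerDr scalerA -normCK a1 expr1n scale1r addrC.
  by rewrite rnormZ a1 mul1r.
have ni : `|'i%C : R[i]| = 1 by rewrite normc_def /= expr0n add0r expr1n sqrtr1.
have h1 := h 1; have h2 := h (-1); have h3 := h 'i%C; have h4 := h (- 'i%C).
move: h1 h2 h3 h4; rewrite !normrN normr1 ni !scaleNr !scale1r.
by move=> /(_ erefl) -> /(_ erefl) -> /(_ erefl) -> /(_ erefl) ->.
Qed.

End HilbertSchmidt.

(** * Trace and trace norm *)

Section TraceNorm.
Context {R : realType} {H : hilbertType R} (sepH : separable_space H).
Implicit Types (x y z : H) (S T X Y F K : H -> H).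

(** Working form of trace class: stability under products and adjoints is read off the factors.
    [nuclear_of_trnorm] and [trnorm_tnorm] relate it to a finite [trnorm]. *)
Definition nuclear T : Prop :=
  exists X Y, [/\ hilbert_schmidt X, hilbert_schmidt Y & T = X \o Y].

Lemma nuclear_bounded T : nuclear T -> bounded_op T.
Proof. by move=> [X [Y [[bX _] [bY _] ->]]]; exact: bounded_comp. Qed.

Lemma nuclear_compl F T : bounded_op F -> nuclear T -> nuclear (F \o T).
Proof.
move=> bF [X [Y [hX hY ->]]]; exists (F \o X), Y; split=> //.
exact: hilbert_schmidt_compl.
Qed.

Lemma nuclear_compr F T : bounded_op F -> nuclear T -> nuclear (T \o F).
Proof.
move=> bF [X [Y [hX hY ->]]]; exists X, (Y \o F); split=> //.
exact: hilbert_schmidt_compr.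
Qed.

Lemma nuclear_adj T : nuclear T -> nuclear (adjop T).
Proof.
move=> [X [Y [hX hY ->]]]; exists (adjop Y), (adjop X).
split; [exact: hilbert_schmidt_adj|exact: hilbert_schmidt_adj|].
by apply: adj_comp; [case: hX|case: hY].
Qed.

Lemma nuclearZ (a : R[i]) T : nuclear T -> nuclear (a *: T).
Proof.
move=> nT; have -> : a *: T = (a *: @id H) \o T by [].
by apply: nuclear_compl => //; apply: boundedZ; exact: bounded_id.
Qed.

Lemma nuclear_has_trace T : nuclear T -> has_trace T (optr T).
Proof.
move=> [X [Y [hX hY ->]]]; have [bX _] := hX.
have := has_trace_form hY (hilbert_schmidt_adj sepH hX); rewrite adjK// => h.
by rewrite (optr_has_trace h).
Qed.

Lemma optr_hs_comm X Y : hilbert_schmidt X -> hilbert_schmidt Y -> optr (X \o Y) = optr (Y \o X).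
Proof.
move=> hX hY; have [[bX _] [bY _]] := (hX, hY).
have := has_trace_form hY (hilbert_schmidt_adj sepH hX); rewrite adjK// => /optr_has_trace ->.
have := has_trace_form hX (hilbert_schmidt_adj sepH hY); rewrite adjK// => /optr_has_trace ->.
by rewrite -[in LHS](adjK bY) hs_form_cyclic//; exact: bounded_adj.
Qed.

(** tr (F X Y) = tr (Y F X) = tr (X Y F), where each exchange involves two Hilbert-Schmidt operators
    only. *)
Lemma optr_comm F T : bounded_op F -> nuclear T -> optr (F \o T) = optr (T \o F).
Proof.
move=> bF [X [Y [hX hY ->]]].
rewrite (@optr_hs_comm (F \o X) Y)//; last exact: hilbert_schmidt_compl.
rewrite -[RHS]/(optr (X \o (Y \o F))) (@optr_hs_comm X (Y \o F))//.
exact: hilbert_schmidt_compr.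
Qed.

Lemma optr_adj T : nuclear T -> optr (adjop T) = (optr T)^*%R.
Proof.
move=> nT; apply/optr_has_trace/has_trace_adj; first exact: nuclear_bounded.
exact: nuclear_has_trace.
Qed.

Lemma optrZ (a : R[i]) T : nuclear T -> optr (a *: T) = a * optr T.
Proof. by move=> nT; apply/optr_has_trace/has_traceZ/nuclear_has_trace. Qed.

Lemma optrD S T : nuclear S -> nuclear T -> optr (S + T) = optr S + optr T.
Proof.
by move=> nS nT; apply/optr_has_trace/has_traceD; exact: nuclear_has_trace.
Qed.

Lemma trnorm_bas T : bounded_op T ->
  trnorm T = (\sum_(0 <= i <oo) (rdot (opabs T (bas i)) (bas i))%:E)%E.
Proof.
move=> bT; rewrite /trnorm eseries_mkcond; apply: eq_eseriesr => i _.
by rewrite /bas; case: ifP => // _; rewrite /rdot inner0r.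
Qed.

Definition sqrt_abs T : H -> H := opsqrt (opabs T).

Lemma positive_sqrt_abs T : bounded_op T -> positive_op (sqrt_abs T).
Proof. by move=> /positive_abs/opsqrtP[]. Qed.

Lemma sqrt_abs_sqr T : bounded_op T -> sqrt_abs T \o sqrt_abs T = opabs T.
Proof. by move=> /positive_abs/opsqrtP[]. Qed.

Lemma rnorm_sqrt_abs T x : bounded_op T -> rnorm (sqrt_abs T x) ^+ 2 = rdot (opabs T x) x.
Proof.
move=> bT; rewrite -sqrt_abs_sqr//= -rdot_self [RHS]positive_rdotC//.
exact: positive_sqrt_abs.
Qed.

Lemma trnorm_hs T : bounded_op T -> trnorm T = hs (sqrt_abs T).
Proof.
by move=> bT; rewrite trnorm_bas//; apply: eq_eseriesr => i _; rewrite rnorm_sqrt_abs.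
Qed.

Lemma hilbert_schmidt_sqrt_abs T : bounded_op T ->
  (trnorm T < +oo)%E -> hilbert_schmidt (sqrt_abs T).
Proof.
by move=> bT; rewrite trnorm_hs// => ?; split=> //; exact/positive_bounded/positive_sqrt_abs.
Qed.

Lemma nuclear_of_trnorm T : bounded_op T -> (trnorm T < +oo)%E -> nuclear T.
Proof.
move=> bT tT; have hK := hilbert_schmidt_sqrt_abs bT tT.
exists (polarop T \o sqrt_abs T), (sqrt_abs T); split=> //.
  exact: hilbert_schmidt_compl (contractive_bounded (polar_contractive bT)) hK.
have [_ TE _] := polarP bT.
by rewrite -[RHS]/(polarop T \o (sqrt_abs T \o sqrt_abs T)) sqrt_abs_sqr.
Qed.

Definition tnorm T : R := fine (trnorm T).

Lemma nuclear_abs T : nuclear T -> nuclear (opabs T).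
Proof.
move=> nT; have bT := nuclear_bounded nT; rewrite -polar_adj_comp//.
by apply: nuclear_compl => //; apply/bounded_adj/contractive_bounded/polar_contractive.
Qed.

(** A convergent trace of |T| makes the extended sum finite; [nuclearD] obtains finiteness this
    way. *)
Lemma trnorm_of_has_trace T t : bounded_op T -> has_trace (opabs T) t ->
  trnorm T = (complex.Re t)%:E.
Proof.
move=> bT [ht _]; rewrite trnorm_bas//; apply/cvg_lim => //; apply: cvg_EFin.
  by near=> n; rewrite sumEFin.
apply: cvg_trans ht; apply: near_eq_cvg; near=> n; rewrite /= sumEFin /=.
by elim/big_rec2: _ => // i u v _ <-; rewrite /rdot; case: (inner _ _) (v) => ? ? [].
Unshelve. all: by end_near. Qed.

Lemma trnorm_tnorm T : nuclear T -> trnorm T = (tnorm T)%:E.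
Proof.
move=> nT; have h := nuclear_has_trace (nuclear_abs nT).
by rewrite /tnorm (trnorm_of_has_trace (nuclear_bounded nT) h).
Qed.

Lemma optr_abs T : nuclear T -> optr (opabs T) = (tnorm T)%:C.
Proof.
move=> nT; have bT := nuclear_bounded nT.
have h := nuclear_has_trace (nuclear_abs nT).
rewrite /tnorm (trnorm_of_has_trace bT h) /=.
have := optr_adj (nuclear_abs nT); rewrite positive_adj; last exact: positive_abs.
by case: (optr _) => a b [] /eqP; rewrite -addr_eq0 -mulr2n mulrn_eq0 => /eqP ->.
Qed.

Lemma tnorm_ge0 T : nuclear T -> 0 <= tnorm T.
Proof. by move=> /nuclear_bounded bT; rewrite /tnorm trnorm_hs// fine_ge0// hs_ge0. Qed.

Lemma bas_ext S T : bounded_op S -> bounded_op T -> (forall i, S (bas i) = T (bas i)) -> S = T.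
Proof.
move=> bS bT h; apply/funext => x; apply: inner_ext => y; rewrite !adjE//; congr inner.
apply/eqP; rewrite -subr_eq0; apply/eqP/(bas_total sepH) => i.
by rewrite innerBl !adjEr// h subrr.
Qed.

(* With T = U K K for the root K of |T|, tr (F T) = tr (K F U K), where F U is
   a contraction. *)
Lemma optr_contractive F T : contractive F -> nuclear T ->
  complex.Re (optr (F \o T)) <= tnorm T /\
  (complex.Re (optr (F \o T)) = tnorm T -> F \o T = opabs T).
Proof.
move=> cF nT; have bT := nuclear_bounded nT.
pose K := sqrt_abs T; have pK : positive_op K by exact: positive_sqrt_abs.
have hK : hilbert_schmidt K.
  by apply: hilbert_schmidt_sqrt_abs => //; rewrite trnorm_tnorm// ltry.
pose C := F \o polarop T; have cC : contractive C.
  by apply: contractive_comp => //; exact: polar_contractive.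
have FT : F \o T = (C \o K) \o K.
  have [_ TE _] := polarP bT; rewrite {1}TE.
  by rewrite -[RHS]/(F \o (polarop T \o (K \o K))) sqrt_abs_sqr.
have hCK := hilbert_schmidt_compl (contractive_bounded cC) hK.
have nKCK : nuclear (K \o (C \o K)) by exists K, (C \o K).
(* The real part of the i-th diagonal entry of K (1 - C) K, nonnegative because C is a contraction;
   these terms add up to the defect in the inequality. *)
pose u i := rnorm (K (bas i)) ^+ 2 - rdot (C (K (bas i))) (K (bas i)).
have u0 i : 0 <= u i.
  rewrite subr_ge0; apply: (le_trans (cauchy_schwarz_rdot _ _)).
  by rewrite expr2 ler_wpM2r ?rnorm_ge0//; case: cC.
pose s n := \sum_(0 <= i < n) u i.
have sE : s @ \oo --> tnorm T - complex.Re (optr (F \o T)).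
  rewrite FT optr_hs_comm//.
  have [h1 _] := nuclear_has_trace nKCK.
  have h2 := sqsum_cvg hK; rewrite -trnorm_hs// -/(tnorm T) in h2.
  have -> : s = (fun n => sqsum K n -
      complex.Re (\sum_(0 <= i < n) inner ((K \o (C \o K)) (bas i)) (bas i))).
    apply/funext => n; rewrite /s /u sumrB /=; congr (_ - _).
    elim/big_rec2: _ => // i a b _ ->; rewrite -(positive_rdotC _ _ pK).
    by rewrite /rdot; case: (inner _ _) (a) => ? ? [].
  exact: cvgB.
have ms : nondecreasing_seq s.
  by apply/nondecreasing_seqP => n; rewrite /s big_nat_recr//= lerDl.
have cs : cvgn s by apply/cvg_ex; eexists; exact: sE.
have s0 n : s n <= tnorm T - complex.Re (optr (F \o T)).
  by rewrite -(cvg_lim _ sE)//; exact: nondecreasing_cvgn_le.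
split; first by have := s0 0%N; rewrite /s big_geq// subr_ge0.
move=> E; rewrite FT.
(* When the defect is 0 every [u i] vanishes, so C fixes each K e_i by [contractive_fixed]. *)
suff -> : C \o K = K by exact: sqrt_abs_sqr.
apply: bas_ext; [by apply: bounded_comp; [case: cC|case: pK]|by case: pK|move=> i /=].
apply: contractive_fixed => //; apply/eqP; rewrite eq_sym -subr_eq0 -/(u i) eq_le u0 andbT.
have si : s i.+1 <= 0 by have := s0 i.+1; rewrite E subrr.
apply: (@le_trans _ _ (s i.+1)) => //.
by rewrite /s big_nat_recr//= lerDr sumr_ge0.
Unshelve. all: by end_near. Qed.
End TraceNorm.

(** * Duality with contractions and the norm properties of the trace norm *)

Section TraceNormInequalities.
Context {R : realType} {H : hilbertType R} (sepH : separable_space H).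
Implicit Types (x y z : H) (A S T F P : H -> H).

Lemma comp_opD F S T : linear F -> F \o (S + T) = (F \o S) + (F \o T).
Proof. by move=> lF; apply/funext => x; rewrite /= linD. Qed.

Lemma comp_opZ F (a : R[i]) T : linear F -> F \o (a *: T) = a *: (F \o T).
Proof. by move=> lF; apply/funext => x; rewrite /= linZ. Qed.

Lemma comp_opB F S T : linear F -> F \o (S - T) = (F \o S) - (F \o T).
Proof. by move=> lF; apply/funext => x; rewrite /= linB. Qed.

Lemma norm_optr_le F T : contractive F -> nuclear T -> `|optr (F \o T)| <= (tnorm T)%:C.
Proof.
move=> cF nT; have [u u1 uE] := phase (optr (F \o T)).
have cuF : contractive (u *: F) by apply: contractiveZ; rewrite ?u1.
have [h _] := optr_contractive sepH cuF nT; move: h.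
rewrite -[(u *: F) \o T]/(u *: (F \o T)) optrZ//; last first.
  by apply: nuclear_compl => //; exact: contractive_bounded.
by rewrite uE -lecR RRe_real// normr_real.
Qed.

Lemma optr_eq_tnorm F T : contractive F -> nuclear T ->
  optr (F \o T) = (tnorm T)%:C -> F \o T = opabs T.
Proof. by move=> cF nT h; have [_] := optr_contractive sepH cF nT; apply; rewrite h. Qed.

Lemma optr_polar T : nuclear T -> optr (adjop (polarop T) \o T) = (tnorm T)%:C.
Proof.
by move=> nT; rewrite polar_adj_comp ?(optr_abs sepH)//; exact: (nuclear_bounded nT).
Qed.

Lemma contractive_polar_adj T : bounded_op T -> contractive (adjop (polarop T)).
Proof. by move=> bT; apply/contractive_adj/polar_contractive. Qed.

(** ||S||_1 = tr (U^* S) is real, so it equals its conjugate tr (S^* U) = tr (U S^* ), which is at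
    most ||S^*||_1; apply this to T and to its adjoint. *)
Lemma tnorm_adj T : nuclear T -> tnorm (adjop T) = tnorm T.
Proof.
have h S : nuclear S -> tnorm S <= tnorm (adjop S).
  move=> nS; have bS := nuclear_bounded nS.
  have cU := polar_contractive bS; have bU := contractive_bounded cU.
  rewrite -lecR -optr_polar//; apply: le_trans (norm_optr_le cU (nuclear_adj sepH nS)).
  have nUS : nuclear (adjop (polarop S) \o S) by apply: nuclear_compl => //; exact: bounded_adj.
  rewrite (optr_comm sepH bU (nuclear_adj sepH nS)).
  have -> : adjop S \o polarop S = adjop (adjop (polarop S) \o S).
    by rewrite adj_comp ?adjK//; exact: bounded_adj.
  by rewrite optr_adj// norm_conjC real_ler_norm// optr_polar// complex_real.
move=> nT; apply/eqP; rewrite eq_le h// andbT.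
by have := h _ (nuclear_adj sepH nT); rewrite adjK//; exact: nuclear_bounded.
Qed.

(** A factorization of the sum is not visible from those of the terms. But |S + T| = U^* S + U^* T
    for the polar part U of the sum, so it has a trace by additivity. *)
Lemma nuclearD S T : nuclear S -> nuclear T -> nuclear (S + T).
Proof.
move=> nS nT; have bST := boundedD (nuclear_bounded nS) (nuclear_bounded nT).
apply: nuclear_of_trnorm => //; have cU := contractive_polar_adj bST.
have bU := contractive_bounded cU.
have hS := nuclear_has_trace sepH (nuclear_compl bU nS).
have hT := nuclear_has_trace sepH (nuclear_compl bU nT).
have := has_traceD hS hT; rewrite -comp_opD; last exact: bounded_lin.
by rewrite polar_adj_comp// => /(trnorm_of_has_trace bST) ->; rewrite ltry.
Qed.

Lemma tnormD S T : nuclear S -> nuclear T -> tnorm (S + T) <= tnorm S + tnorm T.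
Proof.
move=> nS nT; have nST := nuclearD nS nT; have cU := contractive_polar_adj (nuclear_bounded nST).
have bU := contractive_bounded cU.
rewrite -lecR rmorphD /= -optr_polar// comp_opD; last exact: bounded_lin.
rewrite optrD//; try exact: nuclear_compl.
have h1 := norm_optr_le cU nS; have h2 := norm_optr_le cU nT.
apply: le_trans (lerD h1 h2); apply: le_trans (ler_normD _ _).
rewrite -optrD//; try exact: nuclear_compl.
by rewrite -comp_opD ?optr_polar//; [apply: real_ler_norm; rewrite complex_real|exact: bounded_lin].
Qed.

Lemma absZ (a : R[i]) T : bounded_op T -> opabs (a *: T) = `|a| *: opabs T.
Proof.
move=> bT; have lA := bounded_lin (bounded_abs bT).
have aE : `|a| = (complex.Re `|a|)%:C by rewrite RRe_real// normr_real.
apply: abs_unique.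
  by rewrite aE; apply: positiveZ; [rewrite -ler0c -aE|exact: positive_abs].
rewrite adjZ// -[(a^*%R *: _) \o _]/(a^*%R *: (adjop T \o (a *: T))).
rewrite -[(`|a| *: _) \o _]/(`|a| *: (opabs T \o (`|a| *: opabs T))).
rewrite !comp_opZ ?abs_sqr// ?scalerA; last exact: (bounded_lin (bounded_adj bT)).
by rewrite -expr2 normCK mulrC.
Qed.

Lemma tnormZ (a : R[i]) T : nuclear T -> tnorm (a *: T) = complex.Re `|a| * tnorm T.
Proof.
move=> nT; apply: complexI; rewrite -(optr_abs sepH (nuclearZ a nT)) absZ; last exact: nuclear_bounded.
rewrite (optrZ sepH _ (nuclear_abs nT)) (optr_abs sepH nT).
by rewrite [RHS]rmorphM; congr (_ * _); rewrite RRe_real// normr_real.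
Qed.

Lemma tnormZ1 (a : R[i]) T : `|a| = 1 -> nuclear T -> tnorm (a *: T) = tnorm T.
Proof. by move=> a1 nT; rewrite tnormZ// a1 mul1r. Qed.

End TraceNormInequalities.

(** * The unit circle *)

Section Expi.
Context {R : realType}.
Implicit Types (s t : R).

Lemma expiD s t : expi (s + t) = expi s * expi t.
Proof. by rewrite /expi cosD sinD; apply/eqP; rewrite eq_complex /= eqxx addrC [cos s * _]mulrC mulrC eqxx. Qed.

Lemma expiN t : expi (- t) = (expi t)^*%R.
Proof. by rewrite /expi cosN sinN. Qed.

Lemma norm_expi t : `|expi t| = 1.
Proof. by rewrite normc_def /= cos2Dsin2 sqrtr1. Qed.

(** The bounded range of angles lets the supremum in [w1] be sought on a compact interval. *)
Lemma expi_surj (z : R[i]) : `|z| = 1 -> exists2 t, - pi <= t <= pi & expi t = z.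
Proof.
case: z => a b z1.
have ab : a ^+ 2 + b ^+ 2 = 1.
  by apply: complexI; have := add_Re2_Im2 (a +i* b); rewrite z1 expr1n.
have a1 : -1 <= a <= 1 by have := sqr_ge0 b; nra.
have [a0 api] := (acos_ge0 a1, acos_lepi a1).
have cosE : cos (acos a) = a by rewrite acosK// in_itv.
have sinE : sin (acos a) = `|b|.
  by rewrite sin_acos// -sqrtr_sqr -ab addrAC subrr add0r.
have p0 := pi_ge0 R.
have [b0|b0] := leP 0 b.
  by exists (acos a); [lra|rewrite /expi cosE sinE ger0_norm].
by exists (- acos a); [lra|rewrite /expi cosN sinN cosE sinE ltr0_norm// opprK].
Qed.

End Expi.

(** * The conditions of the theorem *)

Section AbsIdentities.
Context {R : realType} {H : hilbertType R}.
Variables (A : H -> H) (bA : bounded_op A).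
Implicit Types (lam : R[i]) (F T V : H -> H).

Let bA' : bounded_op (adjop A) := bounded_adj bA.
Let lA : linear A := bounded_lin bA.
Let lA' : linear (adjop A) := bounded_lin bA'.

(** F preserves the norm of T x, which is that of |T| x, so F^* F fixes T x. *)
Lemma contractive_abs_adj F T : contractive F -> bounded_op T -> F \o T = opabs T ->
  adjop F \o opabs T = T.
Proof.
move=> cF bT FT; apply/funext => x /=; rewrite -FT /=.
apply: contractive_isometric => //.
by rewrite -[F (T x)]/((F \o T) x) FT rnorm_abs.
Qed.

(* V* V is the identity on the range of |A|, as V is isometric there. *)
Lemma polar_square lam V : contractive V -> A = V \o opabs A ->
  adjop A = lam *: (V \o opabs (adjop A)) ->
  adjop A \o adjop A = lam *: (opabs A \o opabs (adjop A)).
Proof.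
move=> cV AE A'E; have bV := contractive_bounded cV.
have VVA : adjop V \o A = opabs A.
  apply/funext => x /=; rewrite {1}AE /=; apply: contractive_isometric => //.
  by rewrite rnorm_abs// [in RHS]AE.
have VA : adjop A \o V = opabs A.
  have <- : adjop (opabs A) = opabs A by exact/positive_adj/positive_abs.
  by rewrite -VVA adj_comp ?adjK//; exact: bounded_adj.
by rewrite {2}A'E comp_opZ// -VA.
Qed.

(** By uniqueness of positive roots it suffices to compare squares: the cross terms |A| |A^*| and
    |A^*| |A| are conj(lam) A^* A^* and lam A A. *)
Lemma square_abs lam : `|lam| = 1 ->
  adjop A \o adjop A = lam *: (opabs A \o opabs (adjop A)) ->
  opabs (A + lam^*%R *: adjop A) = opabs A + opabs (adjop A).
Proof.
move=> lam1 E; set P := opabs A in E *; set Q := opabs (adjop A) in E *.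
have pP : positive_op P by exact: positive_abs.
have pQ : positive_op Q by exact: positive_abs.
have [bP bQ] := (positive_bounded pP, positive_bounded pQ).
have ll : lam^*%R * lam = 1 by rewrite mulrC -normCK lam1 expr1n.
have E1 : lam^*%R *: (adjop A \o adjop A) = P \o Q by rewrite E scalerA ll scale1r.
have E2 : lam *: (A \o A) = Q \o P.
  have <- : adjop (P \o Q) = Q \o P by rewrite adj_comp// !positive_adj.
  rewrite -E1 adjZ ?conjCK; last exact: bounded_comp.
  by rewrite adj_comp// adjK.
apply: abs_unique; first exact: positiveD.
rewrite adjD// ?adjZ// ?conjCK ?adjK//; last exact: boundedZ.
have [lP lQ] := (bounded_lin bP, bounded_lin bQ).
rewrite -[LHS]/((P \o (P + Q)) + (Q \o (P + Q))).
rewrite -[RHS]/((adjop A \o (A + lam^*%R *: adjop A)) + lam *: (A \o (A + lam^*%R *: adjop A))).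
rewrite !comp_opD// !comp_opZ// -E1 -E2 scalerDr scalerA mulrC ll scale1r.
by rewrite abs_sqr// abs_sqr// adjK.
Qed.

End AbsIdentities.

(** * Parallelism of A and its adjoint through norming contractions *)

Section Parallel.
Context {R : realType} {H : hilbertType R} (sepH : separable_space H).
Variables (A : H -> H) (nA : nuclear A).
Implicit Types (lam : R[i]) (F S T U V W : H -> H).

Let bA : bounded_op A := nuclear_bounded nA.
Let nA' : nuclear (adjop A) := nuclear_adj sepH nA.
Let bA' : bounded_op (adjop A) := bounded_adj bA.

Definition norming lam F : Prop :=
  [/\ contractive F, optr (F \o A) = (tnorm A)%:C & lam * optr (F \o adjop A) = (tnorm A)%:C].

Lemma norming_abs lam F : `|lam| = 1 -> norming lam F ->
  F \o A = opabs A /\ lam *: (F \o adjop A) = opabs (adjop A).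
Proof.
move=> lam1 [cF FA FA']; split; first exact: (optr_eq_tnorm sepH).
have := @optr_eq_tnorm _ _ sepH F (lam *: adjop A) cF (nuclearZ lam nA').
rewrite comp_opZ; last exact/bounded_lin/contractive_bounded.
rewrite optrZ ?FA'//; last by apply: nuclear_compl => //; exact: contractive_bounded.
rewrite tnormZ1 ?(tnorm_adj sepH)// absZ// lam1 scale1r.
by apply.
Qed.

Lemma nuclear_parallel lam : nuclear (A + lam *: adjop A).
Proof. by apply: (nuclearD sepH) => //; exact: nuclearZ. Qed.

Lemma optr_comp_parallel lam F : bounded_op F ->
  optr (F \o (A + lam *: adjop A)) = optr (F \o A) + lam * optr (F \o adjop A).
Proof.
move=> bF; have lF := bounded_lin bF.
rewrite comp_opD// comp_opZ// (optrD sepH) ?(optrZ sepH)//; try exact: nuclear_compl.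
by apply: nuclearZ; exact: nuclear_compl.
Qed.

Lemma norming_parallel lam F : `|lam| = 1 -> norming lam F ->
  tnorm (A + lam *: adjop A) = tnorm A + tnorm (adjop A).
Proof.
move=> lam1 [cF FA FA']; apply/eqP; rewrite eq_le.
have := tnormD sepH nA (nuclearZ lam nA'); rewrite tnormZ1// => -> /=.
have := norm_optr_le sepH cF (nuclear_parallel lam).
rewrite optr_comp_parallel ?FA ?FA'; last exact: contractive_bounded.
rewrite -rmorphD /= (tnorm_adj sepH)//.
have t0 : 0 <= tnorm A + tnorm A by rewrite addr_ge0// tnorm_ge0.
by rewrite ger0_norm ?ler0c// lecR.
Qed.

(** The real parts of tr (F A) and lam tr (F A^* ) are each at most ||A||_1 and add up to twice
    that, so both are equality cases. *)
Lemma parallel_norming lam : `|lam| = 1 ->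
  tnorm (A + lam *: adjop A) = tnorm A + tnorm (adjop A) ->
  norming lam (adjop (polarop (A + lam *: adjop A))).
Proof.
move=> lam1 E; have nS := nuclear_parallel lam.
have cF := contractive_polar_adj (nuclear_bounded nS).
set F := adjop _ in cF *; have bF := contractive_bounded cF.
have nlA := nuclearZ lam nA'.
have h : optr (F \o A) + lam * optr (F \o adjop A) = (tnorm A + tnorm A)%:C.
  by rewrite -optr_comp_parallel// (optr_polar sepH)// E (tnorm_adj sepH).
have [h1 e1] := optr_contractive sepH cF nA.
have [h2 e2] := optr_contractive sepH cF nlA.
move: h2 e2; rewrite comp_opZ; last exact: bounded_lin.
rewrite (optrZ sepH); last exact: nuclear_compl.
rewrite tnormZ1// (tnorm_adj sepH)// => h2 e2.
have hr : complex.Re (optr (F \o A)) + complex.Re (lam * optr (F \o adjop A)) = tnorm A + tnorm A.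
  by move/(congr1 (@complex.Re R)): h => /= <-; case: (optr _) (lam * _) => ? ? [].
have {}e1 : F \o A = opabs A by apply: e1; lra.
have {}e2 : lam *: (F \o adjop A) = opabs (lam *: adjop A) by apply: e2; lra.
split=> //; first by rewrite e1 (optr_abs sepH).
rewrite -(optrZ sepH) ?e2; last exact: nuclear_compl.
by rewrite (optr_abs sepH)// tnormZ1// (tnorm_adj sepH).
Qed.

Lemma norming_polar lam F : `|lam| = 1 -> norming lam F ->
  A = adjop F \o opabs A /\ adjop A = lam^*%R *: (adjop F \o opabs (adjop A)).
Proof.
move=> lam1 nF; have [cF _ _] := nF; have [FA FA'] := norming_abs lam1 nF.
have bF := contractive_bounded cF.
split; first by rewrite contractive_abs_adj.
have bl : bounded_op (lam *: adjop A) by exact: boundedZ.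
have absE : opabs (lam *: adjop A) = opabs (adjop A) by rewrite absZ// lam1 scale1r.
have h : F \o (lam *: adjop A) = opabs (lam *: adjop A).
  by rewrite absE comp_opZ//; exact: bounded_lin.
rewrite -absE contractive_abs_adj// scalerA.
by rewrite mulrC -normCK lam1 expr1n scale1r.
Qed.

Lemma optr_isometry_conj V T : isometry_op V -> nuclear T ->
  nuclear (V \o T \o adjop V) /\ optr (V \o T \o adjop V) = optr T.
Proof.
move=> [lV iV] nT.
have cV : contractive V.
  have nV x : rnorm (V x) = rnorm x by rewrite /rnorm iV.
  split; last by move=> x; rewrite nV.
  by apply/bounded_opP; split=> //; exists 1 => // x; rewrite nV mul1r.
have bV := contractive_bounded cV; have bV' := bounded_adj bV.
have nTV := nuclear_compr sepH bV' nT.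
split; first exact: (nuclear_compl bV nTV).
rewrite -[V \o T \o adjop V]/(V \o (T \o adjop V)) (optr_comm sepH bV nTV).
congr optr; apply/funext => x /=; congr (T _).
by apply: contractive_isometric => //; rewrite /rnorm iV.
Qed.

(** Take traces on both sides: conjugation by an isometry preserves them. *)
Lemma isometries_parallel lam V W : isometry_op V -> isometry_op W ->
  opabs (A + lam *: adjop A) = (V \o opabs A \o adjop V) + (W \o opabs (adjop A) \o adjop W) ->
  tnorm (A + lam *: adjop A) = tnorm A + tnorm (adjop A).
Proof.
move=> iV iW E; apply: complexI; rewrite rmorphD /=.
have [n1 e1] := optr_isometry_conj iV (nuclear_abs nA).
have [n2 e2] := optr_isometry_conj iW (nuclear_abs nA').
by rewrite -!(optr_abs sepH)// ?E ?(optrD sepH)// ?e1 ?e2//; exact: nuclear_parallel.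
Qed.

End Parallel.

(** * The sign of a self-adjoint operator as a reflection *)

Section Sign.
Context {R : realType} {H : hilbertType R} (sepH : separable_space H).
Implicit Types (A B S T F : H -> H) (M : set H).

(** The symmetry 2 P - 1, equal to 1 on M and to -1 on its orthogonal complement. *)
Definition reflection M : H -> H := orthproj M + orthproj M - @id H.

Lemma reflectionE M x : reflection M x = orthproj M x + orthproj M x - x.
Proof. by []. Qed.

Lemma bounded_orthproj M : closed_subspace M -> bounded_op (orthproj M).
Proof. by move=> cM; exact/contractive_bounded/orthproj_contractive. Qed.

Lemma orthproj_idem M x : closed_subspace M -> orthproj M (orthproj M x) = orthproj M x.
Proof. by move=> cM; rewrite orthproj_id//; exact: orthproj_mem. Qed.

Lemma reflection_contractive M : closed_subspace M -> contractive (reflection M).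
Proof.
move=> cM; have bP := bounded_orthproj cM.
split; first by apply: boundedB; [exact: boundedD|exact: bounded_id].
move=> x; apply: rnorm_mono; first exact: rnorm_ge0.
rewrite -(orthproj_pythagoras cM x) reflectionE -addrA -opprB opprB.
have -> : orthproj M x + (orthproj M x - x) = orthproj M x - (x - orthproj M x) by rewrite opprB.
rewrite rnormB_sqr; have [MP xP] := orthprojP x cM.
by rewrite rdotC /rdot xP// mulr0 subr0.
Qed.

Lemma reflection_adj M : closed_subspace M -> adjop (reflection M) = reflection M.
Proof.
move=> cM; have bP := bounded_orthproj cM.
by rewrite adjB ?adjD ?orthproj_adj ?adj_id//; [exact: boundedD|exact: bounded_id].
Qed.

(* The range of |T| + T lies in M := ker (|T| - T), and that of |T| - T is
   orthogonal to M, so the reflection in M is the sign of T. *)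
Lemma reflection_sign T (M := opker (opabs T - T)) : bounded_op T -> adjop T = T ->
  closed_subspace M /\ reflection M \o T = opabs T.
Proof.
move=> bT sT; have pX := positive_abs bT; set X := opabs T in M pX *.
have bX := positive_bounded pX; have [lX lT] := (bounded_lin bX, bounded_lin bT).
have cM : closed_subspace M by apply: closed_subspace_ker; exact: boundedB.
split=> //; apply/funext => x /=.
have XT : T (X x) = X (T x).
  have : T \o X = X \o T.
    by apply: opsqrt_commute => //; [exact: positive_adj_comp|rewrite sT].
  by move/(congr1 (fun f => f x)).
have XX : X (X x) = T (T x).
  by have := abs_sqr bT; rewrite sT => /(congr1 (fun f => f x)).
(* |T| and T commute and have the same square, so (|T| - T) (|T| + T) = 0. *)
have P1 : orthproj M (X x + T x) = X x + T x.
  have Mv : X (X x + T x) - T (X x + T x) = 0.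
    by rewrite (linD lX) (linD lT) XT XX [T (T x) + _]addrC subrr.
  by apply: orthproj_id.
have P2 : orthproj M (X x - T x) = 0.
  apply: orthproj_orth => // y My.
  have {}My : X y - T y = 0 by [].
  rewrite innerBl adjE// positive_adj// adjE// sT -innerBr My; exact: inner0r.
have lP := bounded_lin (bounded_orthproj cM).
rewrite reflectionE -(linD lP).
have -> : T x + T x = (X x + T x) - (X x - T x).
  by rewrite opprB [RHS]addrC addrA subrK.
by rewrite (linB lP) P1 P2 subr0 addrK.
Qed.

Lemma optr_compress M B : closed_subspace M -> nuclear B ->
  optr (orthproj M \o B \o orthproj M) = optr (B \o orthproj M).
Proof.
move=> cM nB; have bP := bounded_orthproj cM.
rewrite -[_ \o _ \o _]/(orthproj M \o (B \o orthproj M)) (optr_comm sepH)//; last first.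
  exact: nuclear_compr.
by congr optr; apply/funext => x /=; rewrite orthproj_idem.
Qed.

Lemma orthproj_orthocompE M : closed_subspace M ->
  orthproj (orthocomp M) = @id H - orthproj M.
Proof. by move=> cM; apply/funext => x; rewrite orthproj_compl. Qed.

(** tr (P B P) = tr (B P) by cyclicity, so the difference is tr (B (P - (1 - P))). *)
Lemma optr_reflection M B : closed_subspace M -> nuclear B ->
  optr (orthproj M \o B \o orthproj M)
    - optr (orthproj (orthocomp M) \o B \o orthproj (orthocomp M)) = optr (reflection M \o B).
Proof.
move=> cM nB; have bP := bounded_orthproj cM; have lB := bounded_lin (nuclear_bounded nB).
have bF := contractive_bounded (reflection_contractive cM).
have cM' := closed_subspace_orthocomp M.
rewrite (optr_compress cM nB) (optr_compress cM' nB) (optr_comm sepH bF nB).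
rewrite orthproj_orthocompE// -mulN1r -(optrZ sepH); last first.
  by apply: nuclear_compr => //; apply: boundedB => //; exact: bounded_id.
rewrite -(optrD sepH); [|exact: nuclear_compr|]; last first.
  by apply/nuclearZ/nuclear_compr => //; apply: boundedB => //; exact: bounded_id.
congr optr; rewrite !comp_opB// comp_opD// scaleN1r opprB addrA.
by congr (_ - _).
Qed.

(** Composing the reflection with P gives P and with Q gives - Q; the compressions of B thus inherit
    the signs required in (8) from |B|. *)
Lemma reflection_compress M B (P := orthproj M) (Q := orthproj (orthocomp M)) :
  closed_subspace M -> bounded_op B -> reflection M \o B = opabs B ->
  P \o B \o P = P \o opabs B \o P /\ Q \o B \o Q = - (Q \o opabs B \o Q).
Proof.
move=> cM bB FB; have lP : linear P := bounded_lin (bounded_orthproj cM).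
have PP y : P (P y) = P y by exact: orthproj_idem.
have FE y : reflection M y = P y + P y - y by [].
have QE y : Q y = y - P y by exact: orthproj_compl.
rewrite -FB; split; apply/funext => x.
  by rewrite -[RHS]/(P (reflection M (B (P x)))) FE (linB lP) (linD lP) PP addrK.
rewrite -[RHS]/(- Q (reflection M (B (Q x)))) [LHS]/(Q (B (Q x))).
move: (B (Q x)) => b; rewrite !QE FE (linB lP) (linD lP) PP addrK.
by rewrite [P b + P b - b]addrAC addrK opprB.
Qed.

Lemma positive_compress B P : bounded_op P -> adjop P = P -> positive_op B ->
  positive_op (P \o B \o P).
Proof.
move=> bP sP [bB pB]; split; first by apply: bounded_comp => //; exact: bounded_comp.
by move=> x /=; rewrite adjE// sP.
Qed.

Lemma negative_opN B : positive_op B -> negative_op (- B).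
Proof.
move=> [bB pB]; split; first by rewrite -scaleN1r; exact: boundedZ.
by move=> x; rewrite fctE innerNl oppr_le0.
Qed.

End Sign.

(** * Conditions (8) and (4) *)

Section Conditions.
Context {R : realType} {H : hilbertType R} (sepH : separable_space H).
Variables (A : H -> H) (nA : nuclear A).
Implicit Types (lam mu : R[i]) (F : H -> H) (M : set H) (theta t : R).

Let bA : bounded_op A := nuclear_bounded nA.
Let nA' : nuclear (adjop A) := nuclear_adj sepH nA.
Let bA' : bounded_op (adjop A) := bounded_adj bA.

Lemma expi_half theta : expi (theta / 2) * expi (theta / 2) = expi theta.
Proof. by rewrite -expiD -splitr. Qed.

(** The half angle makes things symmetric: the rotation carries A + exp(i theta) A^* to B + B^*,
    which is self-adjoint of norm 2 ||B||_1. Its sign must then attain the norm on B and on B^*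
    separately. *)
Lemma norming_split theta F : norming A (expi theta) F ->
  exists M, let B := expi (- (theta / 2)) *: A in
    closed_subspace M /\ reflection M \o B = opabs B.
Proof.
move=> nF; set u := expi (- (theta / 2)); pose B := u *: A.
have u1 : `|u| = 1 by rewrite norm_expi.
have nB : nuclear B by exact: nuclearZ.
have bB := nuclear_bounded nB.
have B'E : adjop B = u^*%R *: adjop A by rewrite adjZ.
have nB' : nuclear (adjop B) by exact: nuclear_adj.
have uJ : u^*%R = u * expi theta.
  by rewrite /u expiN conjCK -(expi_half theta) mulrA -[_^*%R * _]mulrC -normCK norm_expi expr1n mul1r.
pose T := B + adjop B.
have TE : T = u *: (A + expi theta *: adjop A).
  by rewrite /T B'E uJ -scalerA -scalerDr.
have nT : nuclear T by exact: (nuclearD sepH).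
have tT : tnorm T = tnorm B + tnorm B.
  rewrite TE tnormZ1//; last exact: nuclear_parallel.
  rewrite (norming_parallel sepH nA (norm_expi _) nF) tnormZ1//.
  by rewrite (tnorm_adj sepH).
have sT : adjop T = T.
  by rewrite adjD// ?adjK//; [exact: addrC|exact: nuclear_bounded].
have [cM FT] := reflection_sign (nuclear_bounded nT) sT.
set M := opker _ in cM FT; exists M; split=> //.
have cF := reflection_contractive cM; have bF := contractive_bounded cF.
have [h1 e1] := optr_contractive sepH cF nB.
have [h2 _] := optr_contractive sepH cF nB'.
apply: e1; move: h2; rewrite (tnorm_adj sepH)// => h2.
have : optr (reflection M \o T) = (tnorm T)%:C by rewrite FT (optr_abs sepH).
rewrite comp_opD; last exact: bounded_lin.
rewrite (optrD sepH); [|exact: nuclear_compl|exact: nuclear_compl].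
rewrite tT => /(congr1 (@complex.Re R)) /=.
have -> : complex.Re (optr (reflection M \o B) + optr (reflection M \o adjop B)) =
   complex.Re (optr (reflection M \o B)) + complex.Re (optr (reflection M \o adjop B)).
  by case: (optr _) (optr _) => ? ? [].
by move=> h; lra.
Qed.

(** The reflection has trace ||A||_1 against B; this number is real, so conjugation gives the same
    trace against B^*. The rotation is then moved from A to the functional. *)
Lemma split_norming theta M : closed_subspace M ->
  let B := expi (- (theta / 2)) *: A in
  (tnorm A)%:C = optr (orthproj M \o B \o orthproj M)
    - optr (orthproj (orthocomp M) \o B \o orthproj (orthocomp M)) ->
  norming A (expi theta) (expi (- (theta / 2)) *: reflection M).
Proof.
set u := expi _ => cM B; have nB : nuclear B by exact: nuclearZ.
have cF := reflection_contractive cM; have bF := contractive_bounded cF.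
have lF := bounded_lin bF.
rewrite optr_reflection// comp_opZ// => E.
have u1 : `|u| = 1 by rewrite norm_expi.
split; first by apply: contractiveZ; rewrite ?u1.
  by rewrite E.
rewrite -[(u *: _) \o _]/(u *: (reflection M \o adjop A)) (optrZ sepH); last exact: nuclear_compl.
have -> : reflection M \o adjop A = adjop (A \o reflection M).
  by rewrite adj_comp// reflection_adj.
rewrite (optr_adj sepH); last exact: nuclear_compr.
rewrite -(optr_comm sepH)//; move: E; rewrite (optrZ sepH); last exact: nuclear_compl.
move=> /(congr1 (fun w : R[i] => w^*%R)); rewrite rmorphM => E.
rewrite mulrA; have <- : u^*%R = expi theta * u.
  by rewrite /u expiN conjCK -(expi_half theta) -mulrA -normCK norm_expi expr1n mulr1.
by rewrite -E; apply/CrealP; rewrite complex_real.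
Qed.

(** From T^* = |T| U^*, the vector U^* y lies in ker |T| = ker T = ker U, so |U^* y|^2 = Re <y, U
    U^* y> = 0. *)
Lemma polar_adj_ker (T : H -> H) y : bounded_op T -> adjop T y = 0 -> adjop (polarop T) y = 0.
Proof.
move=> bT T'y; have [_ TE kU] := polarP bT; set U := polarop T in TE kU *.
have bU : bounded_op U by exact/contractive_bounded/polar_contractive.
have bX := bounded_abs bT.
have : opker T (adjop U y).
  rewrite -ker_abs// /opker /= -[opabs T]positive_adj; last exact: positive_abs.
  by rewrite -[LHS]/((adjop (opabs T) \o adjop U) y) -adj_comp// -TE.
rewrite -kU => Uy; apply: rnorm_sqr_le0; rewrite -rdot_self rdot_adj ?adjK//; last exact: bounded_adj.
by rewrite /rdot Uy inner0r.
Qed.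

(* F = U* + z P W* P' with W the polar part of G, P and P' the projections onto
   ker A and ker A*; the two summands live on orthogonal subspaces. *)
Lemma compression_norming lam
    (G := orthproj (opker (adjop A)) \o (A + lam *: adjop A) \o orthproj (opker A)) :
  `|lam| = 1 ->
  `|optr (opabs A) + lam * optr (adjop (polarop A) \o adjop A)| <= (tnorm G)%:C ->
  exists F, norming A (- lam) F.
Proof.
move=> lam1; have cK := closed_subspace_ker bA; have cK' := closed_subspace_ker bA'.
set P := orthproj (opker A) in G *; set P' := orthproj (opker (adjop A)) in G *.
have bP : bounded_op P by exact: bounded_orthproj.
have bP' : bounded_op P' by exact: bounded_orthproj.
have nG : nuclear G.
  apply: (nuclear_compr sepH bP); apply: (nuclear_compl bP'); exact: nuclear_parallel.
have [pU AE kU] := polarP bA; set U := polarop A in pU AE kU *.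
have cU : contractive U by exact: partial_isometry_contractive.
have bU := contractive_bounded cU; have bU' := bounded_adj bU.
have cW := contractive_polar_adj (nuclear_bounded nG).
set W := adjop (polarop G) in cW.
have bW := contractive_bounded cW.
have cPWP : contractive (P \o (W \o P')).
  by apply: contractive_comp; [exact: orthproj_contractive|apply: contractive_comp => //; exact: orthproj_contractive].
have bPWP := contractive_bounded cPWP.
have UK' y : opker (adjop A) y -> adjop U y = 0 by exact: polar_adj_ker.
have AP x : A (P x) = 0 by exact: (orthproj_mem cK).
have trW0 : optr ((P \o (W \o P')) \o A) = 0.
  rewrite -[_ \o A]/(P \o ((W \o P') \o A)) (optr_comm sepH) //; last first.
    by apply: nuclear_compl => //; exact: bounded_comp.
  have -> : (W \o P' \o A) \o P = 0 *: A.
    apply/funext => x /=; rewrite AP fctE scale0r.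
    by rewrite (lin0 (bounded_lin bP')) (lin0 (bounded_lin bW)).
  by rewrite (optrZ sepH)// mul0r.
(* The A part has trace 0, so it can be added back; moving P around the trace leaves tr (W G). *)
have trWA : lam * optr ((P \o (W \o P')) \o adjop A) = (tnorm G)%:C.
  have := optr_comp_parallel sepH nA lam bPWP; rewrite trW0 add0r => <-.
  rewrite -[_ \o (A + _)]/(P \o ((W \o P') \o (A + lam *: adjop A))) (optr_comm sepH) //; last first.
    by apply: nuclear_compl; [exact: bounded_comp|exact: nuclear_parallel].
  exact: (optr_polar sepH nG).
have UAE : optr (adjop U \o A) = (tnorm A)%:C by exact: optr_polar.
rewrite (optr_abs sepH)//; set s := _ + _ => sG.
pose g := tnorm G; have g0 : 0 <= g by exact: tnorm_ge0.
(* Chosen so that s + z ||G||_1 = 0, which is the second norming equation for - lam; the hypothesis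
   says |z| <= 1. If ||G||_1 = 0, division by zero gives z = 0, and s = 0 as well. *)
pose z : R[i] := - s / g%:C.
have zg : z * g%:C = - s.
  rewrite /z; have [gz|gz] := eqVneq g 0; last first.
    by rewrite divfK//; apply: contra_neq gz; rewrite -(rmorph0 (real_complex R)) => /complexI.
  by move: sG; rewrite -/g gz normr_le0 => /eqP ->; rewrite oppr0 !mul0r.
have z1 : `|z| <= 1.
  rewrite /z normrM normrN normfV (ger0_norm (_ : 0 <= g%:C)) ?ler0c//.
  have [gz|gz] := eqVneq g 0; first by rewrite gz invr0 mulr0 ler01.
  have gp : 0 < g by rewrite lt_neqAle eq_sym gz.
  by rewrite ler_pdivrMr ?mul1r// ltcR.
exists (adjop U + z *: (P \o (W \o P'))); split.
- split; first by apply: boundedD => //; exact: boundedZ.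
  move=> x; rewrite !fctE /=; apply: rnorm_mono; first exact: rnorm_ge0.
  (* The second summand has its values in ker A = ker U, to which the range of U^* is orthogonal. On
     the input side U^* sees only x - P' x, so Pythagoras applies to both. *)
  have orth : rdot (adjop U x) (z *: P (W (P' x))) = 0.
    rewrite /rdot adjEr//.
    have UP y : U (P y) = 0 by have := orthproj_mem cK y; rewrite -/P -kU.
    by rewrite (linZ (bounded_lin bU)) UP scaler0 inner0r.
  rewrite rnormD_sqr orth mulr0 addr0 -(orthproj_pythagoras cK' x) -/P' addrC.
  have -> : adjop U x = adjop U (x - P' x).
    by rewrite (linB (bounded_lin bU')) (UK' (P' x)) ?subr0//; exact: orthproj_mem.
  have [_ /(_ (x - P' x)) h1] := contractive_adj cU.
  have h2 : rnorm (z *: P (W (P' x))) <= rnorm (P' x).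
    have [_ /(_ (P' x)) h] : contractive (z *: (P \o W)).
      by apply: contractiveZ => //; apply: contractive_comp => //; exact: orthproj_contractive.
    exact: h.
  by rewrite lerD// ler_pXn2r ?nnegrE ?rnorm_ge0.
- rewrite -[X in optr X]/((adjop U \o A) + z *: ((P \o (W \o P')) \o A)).
  rewrite (optrD sepH) ?(optrZ sepH) ?trW0 ?mulr0 ?addr0//; try exact: nuclear_compl.
  by apply: nuclearZ; exact: nuclear_compl.
- rewrite -[X in optr X]/((adjop U \o adjop A) + z *: ((P \o (W \o P')) \o adjop A)).
  rewrite (optrD sepH) ?(optrZ sepH)//; try exact: nuclear_compl; last first.
    by apply: nuclearZ; exact: nuclear_compl.
  by rewrite mulNr mulrDr mulrCA trWA zg /s opprB addrK.
Qed.

(** F A = |A| = U^* A forces F to agree with U^* off ker A^*, and A = F^* |A| forces F to map ker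
    A^* into ker A. Hence F = U^* + P F P', and up to a phase the left side is tr (F G). *)
Lemma norming_compression mu F
    (G := orthproj (opker (adjop A)) \o (A - mu *: adjop A) \o orthproj (opker A)) :
  `|mu| = 1 -> norming A mu F ->
  `|optr (opabs A) - mu * optr (adjop (polarop A) \o adjop A)| <= (tnorm G)%:C.
Proof.
move=> mu1 nF; have [cF FA FA'] := nF; have [FAE _] := norming_abs sepH nA mu1 nF.
have cK := closed_subspace_ker bA; have cK' := closed_subspace_ker bA'.
set P := orthproj (opker A) in G *; set P' := orthproj (opker (adjop A)) in G *.
have bP : bounded_op P by exact: bounded_orthproj.
have bP' : bounded_op P' by exact: bounded_orthproj.
have bF := contractive_bounded cF; have lF := bounded_lin bF.
have cU := polar_contractive bA; set U := polarop A in cU *.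
have bU := contractive_bounded cU; have bU' := bounded_adj bU.
have UA : adjop U \o A = opabs A by exact: polar_adj_comp.
have AP x : A (P x) = 0 by exact: (orthproj_mem cK).
have A'P x : adjop A (P' x) = 0 by exact: (orthproj_mem cK').
have UP' x : adjop U (P' x) = 0 by exact: polar_adj_ker.
have [AE _] := norming_polar sepH nA mu1 nF.
have bD : bounded_op (F - adjop U) by exact: boundedB.
have DA z : (F - adjop U) (A z) = 0.
  have FU : F \o A = adjop U \o A by rewrite FAE UA.
  by rewrite -[LHS]/((F \o A) z - (adjop U \o A) z) FU subrr.
(* The adjoint of F - U^* has its range in ker A^*, to which x - P' x is orthogonal. *)
have DP' x : (F - adjop U) (x - P' x) = 0.
  apply: inner_ext => y; rewrite inner0l adjE//.
  have [_ ->//] := orthprojP x cK'.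
  apply: inner_extr => z; by rewrite inner0r -adjE// -adjE// DA inner0l.
have FP'A x : opker A (F (P' x)).
  rewrite -ker_abs//; have pX := positive_abs bA; have bX := positive_bounded pX.
  apply: inner_ext => y; rewrite inner0l adjE// positive_adj// adjE//.
  by rewrite -[adjop F _]/((adjop F \o opabs A) y) -AE -adjEr// A'P inner0l.
have FE : F = adjop U + (P \o (F \o P')).
  apply/funext => x; rewrite fctE /= [P _]orthproj_id//.
  have := DP' x; rewrite (linB (bounded_lin bD)) => /eqP; rewrite subr_eq0 => /eqP h.
  have {h} : F x - adjop U x = F (P' x) - adjop U (P' x) by exact: h.
  by rewrite UP' subr0 => <-; rewrite addrC subrK.
have nPA : nuclear (P' \o adjop A \o P).
  by apply: (nuclear_compr sepH bP); exact: (nuclear_compl bP').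
have GE : G = - mu *: (P' \o adjop A \o P).
  apply/funext => x; rewrite -[LHS]/(P' ((A - mu *: adjop A) (P x))).
  have -> : (A - mu *: adjop A) (P x) = A (P x) - mu *: adjop A (P x) by [].
  by rewrite AP sub0r -scaleNr (linZ (bounded_lin bP')).
have nG : nuclear G by rewrite GE; exact: nuclearZ.
rewrite (optr_abs sepH)// -FA' -mulrBr.
have -> : optr (F \o adjop A) = optr (adjop U \o adjop A) + optr (F \o (P' \o adjop A \o P)).
  rewrite {1}FE -[(_ + _) \o _]/((adjop U \o adjop A) + (P \o (F \o P' \o adjop A))).
  have n1 : nuclear (F \o P' \o adjop A) by apply: nuclear_compl => //; exact: bounded_comp.
  rewrite (optrD sepH); [|exact: nuclear_compl|exact: nuclear_compl].
  by rewrite (optr_comm sepH bP n1).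
rewrite addrAC subrr add0r -normrN -mulNr -(optrZ sepH); last exact: nuclear_compl.
by rewrite -comp_opZ// -GE; exact: norm_optr_le.
Qed.

End Conditions.

(** * Condition (1): attainment of the supremum in [w1] *)

Section NumericalRadius.
Context {R : realType} {H : hilbertType R} (sepH : separable_space H).
Variables (A : H -> H) (nA : nuclear A).
Implicit Types (lam : R[i]) (F : H -> H) (s t theta : R).

Let bA : bounded_op A := nuclear_bounded nA.
Let nA' : nuclear (adjop A) := nuclear_adj sepH nA.
Let f t : R := tnorm (A + expi t *: adjop A).

(** Factoring exp(i t) / 2 out of the real part leaves A + exp(-2 i t) A^*. *)
Lemma trnorm_opRe t : trnorm (opRe (expi t *: A)) = (2^-1 * f (- (t + t)))%:E.
Proof.
have -> : opRe (expi t *: A) = (2^-1 * expi t) *: (A + expi (- (t + t)) *: adjop A).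
  rewrite /opRe adjZ// -scalerA; congr (_ *: _); rewrite scalerDr scalerA.
  by congr (_ + _ *: _); rewrite opprD expiD expiN mulrA -normCK norm_expi expr1n mul1r.
have nP := nuclear_parallel sepH nA (expi (- (t + t))).
rewrite (trnorm_tnorm sepH (nuclearZ _ nP)).
rewrite tnormZ//; congr (_ * _)%:E.
rewrite normrM norm_expi mulr1 ger0_norm ?invr_ge0//.
by have -> : 2^-1 = (2^-1 : R)%:C :> R[i] by rewrite fmorphV rmorph_nat.
Qed.

Lemma parallel_le t : f t <= tnorm A + tnorm A.
Proof.
have := tnormD sepH nA (nuclearZ (expi t) nA').
by rewrite tnormZ1 ?norm_expi// (tnorm_adj sepH).
Qed.

Lemma parallel_lipschitz s t :
  f s <= f t + (`|cos s - cos t| + `|sin s - sin t|) * tnorm A.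
Proof.
have nP := nuclear_parallel sepH nA (expi t).
have := tnormD sepH nP (nuclearZ (expi s - expi t) nA').
rewrite -addrA -scalerDl [expi t + _]addrC subrK -/(f s) => /le_trans; apply.
rewrite lerD2l tnormZ// (tnorm_adj sepH)// ler_wpM2r ?tnorm_ge0// -lecR.
rewrite RRe_real ?normr_real// [expi s - expi t]complexE.
apply: (le_trans (ler_normD _ _)); rewrite normrM.
have -> : `|'i%C : R[i]| = 1 by rewrite normc_def /= expr0n add0r expr1n sqrtr1.
have nR (r : R) : `|r%:C : R[i]| = `|r|%:C by rewrite normc_def /= expr0n addr0 sqrtr_sqr.
by rewrite mul1r !nR rmorphD /= lexx.
Qed.

Lemma parallel_continuous : continuous f.
Proof.
move=> t; apply/cvgrPdist_lt => e e0.
(* The factor 2 shares the error between cosine and sine; the added 1 covers A = 0. *)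
have k0 : 0 < 2 * (tnorm A + 1) by rewrite mulr_gt0// ltr_wpDl// tnorm_ge0.
have d0 : 0 < e / (2 * (tnorm A + 1)) by rewrite divr_gt0.
have /cvgrPdist_lt/(_ _ d0) hc := @continuous_cos R t.
have /cvgrPdist_lt/(_ _ d0) hs := @continuous_sin R t.
near=> s.
have c1 : `|cos t - cos s| < e / (2 * (tnorm A + 1)) by near: s.
have s1 : `|sin t - sin s| < e / (2 * (tnorm A + 1)) by near: s.
have := parallel_lipschitz s t; have := parallel_lipschitz t s.
rewrite distrC [`|sin s - _|]distrC [`|cos s - _|]distrC.
move: c1 s1; rewrite !ltr_pdivlMr//; set a := `|_|; set b := `|_|.
have [a0 b0] : 0 <= a /\ 0 <= b by split; exact: normr_ge0.
have t0 := tnorm_ge0 nA.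
by rewrite ltr_norml => *; apply/andP; split; nra.
Unshelve. all: by end_near. Qed.

(** [f] is continuous and depends only on exp(i t), so it attains its supremum on [-pi, pi]. As f <=
    2 ||A||_1, equality in (1) means that this bound is reached. *)
Lemma w1_parallel : w1 A = trnorm A <->
  exists theta, tnorm (A + expi theta *: adjop A) = tnorm A + tnorm (adjop A).
Proof.
rewrite (tnorm_adj sepH)// (trnorm_tnorm sepH nA); split=> [wE|[theta tE]].
  have [|c _ cmax] := @EVT_max R f (- pi) pi _ (continuous_subspaceT parallel_continuous).
    by have := pi_ge0 R; lra.
  exists c; apply/eqP; rewrite eq_le parallel_le /=.
  suff : ((tnorm A)%:E <= (2^-1 * f c)%:E)%E by rewrite lee_fin /f; lra.
  rewrite -wE; apply: ge_ereal_sup => _ [t _ <-]; rewrite trnorm_opRe lee_fin.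
  rewrite ler_pM2l ?invr_gt0//; set t' := - (t + t).
  have [t'' t''pi tE] := expi_surj (norm_expi t').
  by rewrite /f -tE; apply: cmax; rewrite in_itv.
apply/eqP; rewrite eq_le; apply/andP; split.
  apply: ge_ereal_sup => _ [t _ <-]; rewrite trnorm_opRe lee_fin.
  by have := parallel_le (- (t + t)); lra.
apply: ereal_sup_ubound; exists (- (theta / 2)) => //.
rewrite trnorm_opRe -opprD opprK -splitr /f tE; congr _%:E; lra.
Qed.

End NumericalRadius.

Section CompactBounded.
Context {R : realType} {H : hilbertType R}.

(** The conditions |y| < n, for n going to infinity, hold near each point of the compact closure, so
    one n serves for the whole image of the unit ball. *)
Lemma compact_op_bounded (A : H -> H) : compact_op A -> bounded_op A.
Proof.
move=> [lA cA].
have [n hn] : exists n : nat, forall x, rnorm x <= 1 -> rnorm (A x) < n%:R.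
  have /compact_near_coveringP := cA.
  move=> /(_ nat \oo (fun n y => rnorm y < n%:R) _) [].
    move=> x _; exists ([set y | rnorm (x - y) < 1], [set n | rnorm x + 1 < n%:R]).
      split => /=; first by apply/nbhs_rnormP; exists 1.
      exists (Num.truncn (rnorm x + 1)).+1 => // n /= hn.
      by apply: (lt_le_trans (truncnS_gt _)); rewrite ler_nat.
    move=> [y n] /= [xy xn]; apply: le_lt_trans xn.
    have := rnorm_triangle (y - x) x; rewrite subrK rnormBC; lra.
  move=> N _ hN; exists N => x x1; apply: (hN N (leqnn N)).
  by apply: subset_closure; exists x => //=; rewrite rnormE lecR.
apply/bounded_opP; split=> //; exists n%:R => // x.
have [x0|x0] := eqVneq (rnorm x) 0.
  by rewrite (rnorm_eq0 x0) lin0// rnorm0 mulr0.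
have px : 0 < rnorm x by rewrite lt_neqAle eq_sym x0 rnorm_ge0.
have := hn ((rnorm x)^-1%:C *: x).
rewrite linZ// !rnormZR ger0_norm ?invr_ge0 ?rnorm_ge0// mulVf// lexx => /(_ isT).
by rewrite ltr_pdivrMl// mulrC => /ltW.
Qed.

End CompactBounded.

(** * The pivot of the equivalences and its reformulations *)

Section Equivalences.
Context {R : realType} {H : hilbertType R} (sepH : separable_space H).
Variables (A : H -> H) (nA : nuclear A).
Implicit Types (lam : R[i]) (F V : H -> H).

Let nA' : nuclear (adjop A) := nuclear_adj sepH nA.

(** Pivot of the final proof: (2) with real trace norms and a unimodular number instead of an
    angle. *)
Definition parallel_adj : Prop :=
  exists2 lam : R[i], `|lam| = 1 & tnorm (A + lam *: adjop A) = tnorm A + tnorm (adjop A).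

Lemma parallel_adjP :
  parallel_adj <-> exists2 lam : R[i], `|lam| = 1 & exists F, norming A lam F.
Proof.
split=> [[lam l1 E]|[lam l1 [F nF]]]; exists lam => //.
  by exists (adjop (polarop (A + lam *: adjop A))); exact: parallel_norming.
exact: norming_parallel nF.
Qed.

Lemma parallel_adj_expi : parallel_adj <->
  exists theta, tnorm (A + expi theta *: adjop A) = tnorm A + tnorm (adjop A).
Proof.
split=> [[lam /expi_surj[t _ <-]]|[t E]]; first by exists t.
by exists (expi t); first exact: norm_expi.
Qed.

Lemma trnorm_parallel lam :
  trnorm (A + lam *: adjop A) = (trnorm A + trnorm (adjop A))%E <->
  tnorm (A + lam *: adjop A) = tnorm A + tnorm (adjop A).
Proof.
rewrite (trnorm_tnorm sepH nA) (trnorm_tnorm sepH nA').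
rewrite (trnorm_tnorm sepH (nuclear_parallel sepH nA lam)) -EFinD.
by split=> [[]|->].
Qed.

Lemma parallel_polar : parallel_adj -> exists V lam,
  [/\ partial_isometry V, `|lam| = 1, A = V \o opabs A & adjop A = lam *: (V \o opabs (adjop A))].
Proof.
move=> [lam l1 E]; have bS := nuclear_bounded (nuclear_parallel sepH nA lam).
have nF := parallel_norming sepH nA l1 E.
have [h1 h2] := norming_polar sepH nA l1 nF.
have [pW _ _] := polarP bS; have bW : bounded_op (polarop (A + lam *: adjop A)) by case: pW.
exists (polarop (A + lam *: adjop A)), lam^*%R.
by move: h1 h2; rewrite adjK// norm_conjC.
Qed.

(** Entry point from (9) and (10), whose moduli hide the scalar. *)
Lemma norming_phase F : contractive F -> optr (F \o A) = (tnorm A)%:C ->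
  `|optr (F \o adjop A)| = (tnorm A)%:C -> parallel_adj.
Proof.
move=> cF FA FA'; have [u u1 uE] := phase (optr (F \o adjop A)).
by apply/parallel_adjP; exists u => //; exists F; split=> //; rewrite uE.
Qed.

Lemma contractive_opnorm F : bounded_op F -> (opnorm F <= 1)%E <-> forall x, rnorm (F x) <= rnorm x.
Proof.
move=> bF; split=> [F1 x|cF]; last first.
  apply: ge_ereal_sup => _ [x /= x1 <-]; rewrite lee_fin.
  by apply: (le_trans (cF x)); move: x1; rewrite rnormE lecR.
have [x0|x0] := eqVneq (rnorm x) 0.
  by rewrite (rnorm_eq0 x0) lin0//; exact: bounded_lin.
have px : 0 < rnorm x by rewrite lt_neqAle eq_sym x0 rnorm_ge0.
pose y := (rnorm x)^-1%:C *: x.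
have : ((rnorm (F y))%:E <= 1)%E.
  apply: le_trans F1; apply: ereal_sup_ubound; exists y => //=.
  by rewrite rnormE lecR /y rnormZR ger0_norm ?invr_ge0 ?rnorm_ge0// mulVf //.
rewrite lee_fin /y linZ; last exact: bounded_lin.
by rewrite rnormZR ger0_norm ?invr_ge0 ?rnorm_ge0// ler_pdivrMl// mulr1.
Qed.

End Equivalences.

Unset Implicit Arguments.

Theorem corollary5p11 (R : realType) (H : hilbertType R) (A : H -> H)
    (sepH : separable_space H) (tcA : trace_class A) :
  [/\ [<-> (* 1 *)
           w1 A = trnorm A;
           (* 2 *)
           exists theta : R,
             trnorm (A + expi theta *: adjop A) = (trnorm A + trnorm (adjop A))%E;
           (* 3 *)
           exists (V : H -> H) (lam : R[i]),
             [/\ partial_isometry V, `|lam| = 1, A = V \o opabs A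
               & adjop A = lam *: (V \o opabs (adjop A))];
           (* 4 *)
           exists2 lam : R[i], `|lam| = 1 &
             `|optr (opabs A) + lam * optr (adjop (polarop A) \o adjop A)|
               <= trnormC (orthproj (opker (adjop A)) \o (A + lam *: adjop A)
                             \o orthproj (opker A));
           (* 5 *)
           exists2 lam : R[i], `|lam| = 1 &
             adjop A \o adjop A = lam *: (opabs A \o opabs (adjop A));
           (* 6 *)
           exists (V W : H -> H) (lam : R[i]),
             [/\ isometry_op V, isometry_op W, `|lam| = 1
               & opabs (A + lam *: adjop A)
                 = (V \o opabs A \o adjop V) + (W \o opabs (adjop A) \o adjop W)];
           (* 7 *)
           exists2 lam : R[i], `|lam| = 1 &
             opabs (A + lam *: adjop A) = opabs A + opabs (adjop A);
           (* 8 *)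
           exists (theta : R) (M : set H),
             let B := expi (- (theta / 2)) *: A in
             let PBP := orthproj M \o B \o orthproj M in
             let QBQ := orthproj (orthocomp M) \o B \o orthproj (orthocomp M) in
             [/\ closed_subspace M, trnormC A = optr PBP - optr QBQ,
                 positive_op PBP & negative_op QBQ]],
      (* 9 *)
      forall n : nat, has_dim H n ->
        (w1 A = trnorm A <->
         exists F : H -> H,
           [/\ bounded_op F, (opnorm F <= 1)%E, optr (A \o adjop F) = trnormC A
             & trnormC A = `|optr (adjop A \o adjop F)|])
    & (* 10 *)
      forall Ainv : H -> H, bounded_op Ainv ->
        A \o Ainv = id -> Ainv \o A = id ->
        (w1 A = trnorm A <->
         `|optr (opabs A \o Ainv \o adjop A)| = trnormC (adjop A))].
Proof.
have [cA tA] := tcA; have bA := compact_op_bounded cA.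
have nA := nuclear_of_trnorm bA tA.
have bA' := bounded_adj bA; have nA' := nuclear_adj sepH nA.
have w1P : w1 A = trnorm A <-> parallel_adj A.
  by rewrite (w1_parallel sepH nA) parallel_adj_expi.
have square_of_polar (V : H -> H) lam : partial_isometry V -> A = V \o opabs A ->
    adjop A = lam *: (V \o opabs (adjop A)) ->
    adjop A \o adjop A = lam *: (opabs A \o opabs (adjop A)).
  by move=> /partial_isometry_contractive; exact: polar_square.
have square_of_parallel : parallel_adj A -> exists2 lam : R[i], `|lam| = 1 &
    adjop A \o adjop A = lam *: (opabs A \o opabs (adjop A)).
  move=> /(parallel_polar sepH nA)[V [lam [pV l1 AE A'E]]].
  by exists lam => //; exact: square_of_polar A'E.
have abs_of_square : (exists2 lam : R[i], `|lam| = 1 &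
    adjop A \o adjop A = lam *: (opabs A \o opabs (adjop A))) ->
    exists2 lam : R[i], `|lam| = 1 & opabs (A + lam *: adjop A) = opabs A + opabs (adjop A).
  move=> [lam l1 /(square_abs bA l1) E]; exists lam^*%R => //.
  by rewrite norm_conjC.
have isometries_of_abs : (exists2 lam : R[i], `|lam| = 1 &
    opabs (A + lam *: adjop A) = opabs A + opabs (adjop A)) ->
    exists (V W : H -> H) (lam : R[i]), [/\ isometry_op V, isometry_op W, `|lam| = 1
      & opabs (A + lam *: adjop A)
        = (V \o opabs A \o adjop V) + (W \o opabs (adjop A) \o adjop W)].
  by move=> [lam l1 E]; exists id, id, lam; split=> //; rewrite adj_id E.
have parallel_of_isometries : (exists (V W : H -> H) (lam : R[i]),
    [/\ isometry_op V, isometry_op W, `|lam| = 1 & opabs (A + lam *: adjop A)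
        = (V \o opabs A \o adjop V) + (W \o opabs (adjop A) \o adjop W)]) -> parallel_adj A.
  move=> [V [W [lam [iV iW l1 E]]]]; exists lam => //.
  exact: isometries_parallel E.
(* The loop (5), (7), (6), (2) is closed by [square_of_parallel]; the arrows below are composed from
   it. *)
have parallel_of_square h := parallel_of_isometries (isometries_of_abs (abs_of_square h)).
split.
- tfae.
  + move=> /w1P/parallel_adj_expi[theta E]; exists theta.
    exact/trnorm_parallel.
  + move=> [theta /(trnorm_parallel sepH nA) E]; apply: parallel_polar => //.
    by exists (expi theta); first exact: norm_expi.
  + move=> [V [lam [pV l1 AE A'E]]].
    have /(parallel_adjP sepH nA)[mu mu1 [F nF]] : parallel_adj A.
      by apply: parallel_of_square; exists lam => //; exact: square_of_polar A'E.
    (* The scalar of (4) is the opposite of the norming one. *)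
    exists (- mu); first by rewrite normrN.
    rewrite mulNr scaleNr; exact: norming_compression nF.
  + move=> [lam l1 /(compression_norming sepH nA l1)[F nF]]; apply: square_of_parallel.
    by apply/(parallel_adjP sepH nA); exists (- lam); [rewrite normrN|exists F].
  + by move=> /abs_of_square; exact: isometries_of_abs.
  + by move=> /parallel_of_isometries/square_of_parallel/abs_of_square.
  + move=> /isometries_of_abs/parallel_of_isometries/(parallel_adjP sepH nA)[lam].
    move=> /expi_surj[theta _ <-] [F /(norming_split sepH nA)[M]].
    set B := expi _ *: A => -[cM FB].
    have nB : nuclear B by exact: nuclearZ.
    have bB := nuclear_bounded nB; have pB := positive_abs bB.
    have cM' := closed_subspace_orthocomp M.
    have [PE QE] := reflection_compress cM bB FB.
    exists theta, M; split=> //.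
    * rewrite optr_reflection// FB (optr_abs sepH)//; congr _%:C.
      by rewrite /B -/(tnorm A) tnormZ1// norm_expi.
    * rewrite PE; apply: positive_compress => //; first exact: bounded_orthproj.
      exact: orthproj_adj.
    * rewrite QE; apply/negative_opN/positive_compress => //; first exact: bounded_orthproj.
      exact: orthproj_adj.
  + move=> [theta [M [cM E _ _]]]; apply/w1P/(parallel_adjP sepH nA).
    exists (expi theta); first exact: norm_expi.
    by exists (expi (- (theta / 2)) *: reflection M); exact: split_norming.
- move=> n _; rewrite w1P; split=> [/(parallel_adjP sepH nA)[lam l1 [F [cF FA FA']]]|].
    have bF := contractive_bounded cF; have cF' := contractive_adj cF.
    have bF' := contractive_bounded cF'.
    (* (9) pairs A with F^*, so its F is the adjoint of the norming contraction. *)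
    exists (adjop F); rewrite adjK//; split=> //.
    + by apply/contractive_opnorm => //; case: cF'.
    + by rewrite -(optr_comm sepH).
    + rewrite -(optr_comm sepH)// -[RHS]mul1r -l1 -normrM FA'.
      by rewrite ger0_norm// ler0c tnorm_ge0.
  move=> [F [bF /(contractive_opnorm bF) F1 FA FA']].
  have cF : contractive (adjop F) by apply: contractive_adj.
  have bF' := contractive_bounded cF.
  apply: (norming_phase sepH nA cF); first by rewrite (optr_comm sepH).
  by rewrite (optr_comm sepH).
- move=> Ainv bI AI IA; rewrite w1P; split=> [/(parallel_adjP sepH nA)[lam l1 [F nF]]|].
    have [cF _ FA'] := nF; have [FA _] := norming_abs sepH nA l1 nF.
    (* For invertible A, the equation F A = |A| leaves a single candidate; in the converse, U^* A =
       |A| identifies the same operator as U^*. *)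
    have -> : opabs A \o Ainv = F by rewrite -FA -[LHS]/(F \o (A \o Ainv)) AI.
    rewrite -[LHS]mul1r -l1 -normrM FA' /trnormC -/(tnorm (adjop A)) (tnorm_adj sepH)//.
    by rewrite ger0_norm// ler0c tnorm_ge0.
  have -> : opabs A \o Ainv = adjop (polarop A).
    by rewrite -polar_adj_comp// -[LHS]/(adjop (polarop A) \o (A \o Ainv)) AI.
  rewrite /trnormC -/(tnorm (adjop A)) (tnorm_adj sepH)// => E.
  apply: (norming_phase sepH nA) E; last exact: (optr_polar sepH).
  exact: contractive_polar_adj.
Qed.
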